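(* Let $n\ge1$, let $r>0$ and let $s_1<s_2$ be real numbers. Then there is no constant $C>0$ such that the inequality $$\int_{\mathbb{H}^n}|u_0(z,t)|^2\,\mathrm{d}z\,\mathrm{d}t\le C\left(\int_{(\mathbb{R}^{2n}\setminus Q(0,r))\times\mathbb{R}}|u(z,t,s_1)|^2\,\mathrm{d}z\,\mathrm{d}t+\int_{(\mathbb{R}^{2n}\setminus Q(0,r))\times\mathbb{R}}|u(z,t,s_2)|^2\,\mathrm{d}z\,\mathrm{d}t\right)$$ holds for every $u_0\in L^2(\mathbb{H}^n)$, where $u(\cdot,\cdot,s)=e^{is\mathcal{L}}u_0$ is the solution of $i\partial_su(z,t,s)+\mathcal{L}u(z,t,s)=0$ with initial condition $u(z,t,0)=u_0(z,t)$.
   Context: $Q(0,r)=[-r,r]^{2n}\subset\mathbb{R}^{2n}$. The Heisenberg group $\mathbb{H}^n$ is $\mathbb{R}^n\times\mathbb{R}^n\times\mathbb{R}$ with elements $(z,t)=(x,y,t)$, $z=(x,y)\in\mathbb{R}^{2n}$, and group law $(x,y,t)(x',y',t')=\bigl(x+x',y+y',t+t'-\tfrac12\sum_{j=1}^n(x_jy_j'-y_jx_j')\bigr)$. Haar measure is Lebesgue measure $\mathrm{d}z\,\mathrm{d}t$. The sub-Laplacian is $\mathcal{L}=\sum_{j=1}^n (X_j^2+Y_j^2)$ with $X_j=\partial_{x_j}+\tfrac12 y_j\partial_t$ and $Y_j=\partial_{y_j}-\tfrac12x_j\partial_t$. It is self-adjoint on $L^2(\mathbb{H}^n)$ and $e^{is\mathcal{L}}$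 is the associated unitary group. *)

(* Defs.v *)
From HB Require Import structures.
From mathcomp Require Import all_boot all_order all_algebra.
From mathcomp Require Import all_classical all_reals all_analysis.
From mathcomp Require Import complex.

Set Implicit Arguments.
Unset Strict Implicit.
Unset Printing Implicit Defensive.

Import Order.TTheory GRing.Theory Num.Theory.
Import numFieldNormedType.Exports.

Local Open Scope classical_set_scope.
Local Open Scope ring_scope.

(* The sigma-algebra on row vectors generated by the coordinate maps; over the
   reals it is the Borel sigma-algebra, as for the library's [n.-tuple T]. *)
Definition measure_rV_display : measure_display -> measure_display.
Proof. exact. Qed.

Section measurable_rV.
Context {d} {T : measurableType d}.
Variable n : nat.

Let coors : 'I_n -> 'rV[T]_n -> T := fun i v => v ord0 i.

Let rV_set0 : g_sigma_preimage coors set0.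
Proof. exact: sigma_algebra0. Qed.

Let rV_setC A : g_sigma_preimage coors A -> g_sigma_preimage coors (~` A).
Proof. exact: sigma_algebraC. Qed.

Let rV_bigcup (F : _^nat) : (forall i, g_sigma_preimage coors (F i)) ->
  g_sigma_preimage coors (\bigcup_i (F i)).
Proof. exact: sigma_algebra_bigcup. Qed.

HB.instance Definition _ := @isMeasurable.Build (measure_rV_display d)
  'rV[T]_n (g_sigma_preimage coors) rV_set0 rV_setC rV_bigcup.

End measurable_rV.

Lemma measurable_rV_coord d (T : measurableType d) n (i : 'I_n) :
  measurable_fun [set: 'rV[T]_n] (fun v : 'rV[T]_n => v ord0 i).
Proof.
move=> _ Y mY; rewrite setTI; apply: sub_sigma_algebra => /=.
rewrite -bigcup_seq/=; exists i => /=; first by rewrite mem_index_enum.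
by exists Y => //; rewrite setTI.
Qed.

Lemma measurable_fun_rVP d1 d2 (T1 : measurableType d1) (T2 : measurableType d2)
    n (f : T1 -> 'rV[T2]_n) :
  (forall i, measurable_fun [set: T1] (fun x => f x ord0 i)) ->
  measurable_fun [set: T1] f.
Proof.
move=> mf _ Y mY; rewrite setTI.
suff : measurable `<=` [set A | measurable (f @^-1` A)] by apply.
apply: smallest_sub.
  split => /=.
  - by rewrite preimage_set0.
  - by move=> A mA; rewrite setTD preimage_setC; exact: measurableC.
  - by move=> F mF; rewrite preimage_bigcup; exact: bigcup_measurable.
rewrite -bigcup_seq/=; apply: bigcup_sub => i _ _ [B mB <-].
rewrite /= setTI -[X in measurable X]setTI.
exact: (mf i measurableT B mB).
Qed.

(* The sigma-finite instance of the library for [m1 \x m2] is shadowed by the one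
   for subprobabilities, hence this alias. *)
Section sigma_finite_product.
Local Open Scope ereal_scope.
Context d1 d2 (T1 : measurableType d1) (T2 : measurableType d2) (R : realType).
Variable m1 : {sigma_finite_measure set T1 -> \bar R}.
Variable m2 : {sigma_finite_measure set T2 -> \bar R}.

Definition sf_product : set (T1 * T2) -> \bar R := m1 \x m2.

HB.instance Definition _ := Measure.on sf_product.

Let sf_product_sigma_finite : sigma_finite setT sf_product.
Proof.
have /sigma_finiteP[F [TF ndF Foo]] := sigma_finiteT m1.
have /sigma_finiteP[G [TG ndG Goo]] := sigma_finiteT m2.
exists (fun n => F n `*` G n).
  rewrite -setXTT TF TG predeqE => -[x y]; split.
    move=> [/= [n _ Fnx] [k _ Gky]]; exists (maxn n k) => //; split.
    - by move: x Fnx; exact/subsetPset/ndF/leq_maxl.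
    - by move: y Gky; exact/subsetPset/ndG/leq_maxr.
  by move=> [n _ []/= ? ?]; split; exists n.
move=> k; have [? ?] := Foo k; have [? ?] := Goo k.
split; first exact: measurableX.
by rewrite /sf_product product_measure1E// lte_mul_pinfty// ge0_fin_numE.
Qed.

HB.instance Definition _ := @Measure_isSigmaFinite.Build _ _ _
  sf_product sf_product_sigma_finite.

End sigma_finite_product.

Section lebesgue_rV_step.
Local Open Scope ereal_scope.
Variables (R : realType) (n : nat).
Variable m : {sigma_finite_measure set 'rV[R]_n -> \bar R}.

Definition rV_cons (p : measurableTypeR R * 'rV[R]_n) : 'rV[R]_n.+1 :=
  \row_i (if unlift ord0 i is Some j then p.2 ord0 j else p.1).

Let rV_uncons (v : 'rV[R]_n.+1) : measurableTypeR R * 'rV[R]_n :=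
  (v ord0 ord0, \row_j v ord0 (lift ord0 j)).

Let rV_consK : cancel rV_cons rV_uncons.
Proof.
move=> [a v]; congr pair; first by rewrite mxE unlift_none.
by apply/rowP => j; rewrite !mxE liftK.
Qed.

Lemma measurable_rV_cons : measurable_fun setT rV_cons.
Proof.
apply: measurable_fun_rVP => i.
rewrite (_ : (fun _ => _) = fun p : measurableTypeR R * 'rV[R]_n =>
    if unlift ord0 i is Some j then p.2 ord0 j else p.1); last first.
  by apply/funext => p; rewrite mxE.
case: unliftP => [j _|_]; last exact: measurable_fst.
exact: (measurableT_comp (@measurable_rV_coord _ _ _ j)).
Qed.

Let measurable_rV_uncons : measurable_fun setT rV_uncons.
Proof.
apply/measurable_fun_pairP; split; first exact: measurable_rV_coord.
apply: measurable_fun_rVP => i; rewrite (_ : (fun _ => _) =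
    fun v : 'rV[R]_n.+1 => v ord0 (lift ord0 i)); last first.
  by apply/funext => v; rewrite /= mxE.
exact: measurable_rV_coord.
Qed.

#[local] Hint Resolve measurable_rV_cons : core.

Definition lebesgue_rV_step : set 'rV[R]_n.+1 -> \bar R :=
  pushforward (sf_product lebesgue_measure m) rV_cons.

Let lebesgue_rV_step0 : lebesgue_rV_step set0 = 0.
Proof. exact: measure0. Qed.

Let lebesgue_rV_step_ge0 A : 0 <= lebesgue_rV_step A.
Proof. exact: measure_ge0. Qed.

Let lebesgue_rV_step_sigma_additive : semi_sigma_additive lebesgue_rV_step.
Proof. exact: measure_semi_sigma_additive. Qed.

HB.instance Definition _ := isMeasure.Build _ _ _ lebesgue_rV_step
  lebesgue_rV_step0 lebesgue_rV_step_ge0 lebesgue_rV_step_sigma_additive.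

Let lebesgue_rV_step_sigma_finite : sigma_finite setT lebesgue_rV_step.
Proof.
have [F FT mF] := sigma_finiteT (sf_product (@lebesgue_measure R) m).
exists (fun k => rV_uncons @^-1` F k).
  by rewrite -preimage_bigcup -FT preimage_setT.
move=> k; have [mFk Fk] := mF k; split.
  by rewrite -[X in measurable X]setTI; exact: measurable_rV_uncons.
rewrite /lebesgue_rV_step /pushforward -comp_preimage.
by rewrite (_ : rV_uncons \o rV_cons = id) //; apply/funext/rV_consK.
Qed.

HB.instance Definition _ := @Measure_isSigmaFinite.Build _ _ _
  lebesgue_rV_step lebesgue_rV_step_sigma_finite.

End lebesgue_rV_step.

Fixpoint lebesgue_rV (R : realType) (n : nat) :
    {sigma_finite_measure set 'rV[R]_n -> \bar R} :=
  if n is n'.+1 then lebesgue_rV_step (lebesgue_rV R n')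
  else dirac (0 : 'rV[R]_0).

Lemma lebesgue_rV_box (R : realType) (n : nat) (A : 'I_n -> set R) :
  (forall i, measurable (A i)) ->
  lebesgue_rV R n [set v | forall i, A i (v ord0 i)] =
  (\prod_(i < n) lebesgue_measure (A i))%E.
Proof.
elim: n A => [|n IHn] A mA.
  by rewrite big_ord0 /= diracE mem_set// => -[].
rewrite big_ord_recl -(IHn (fun i => A (lift ord0 i))) //.
have mB : measurable [set v : 'rV[R]_n | forall i, A (lift ord0 i) (v ord0 i)].
  rewrite (_ : mkset _ = \bigcap_(i in [set: 'I_n])
      ((fun v : 'rV[R]_n => v ord0 i) @^-1` A (lift ord0 i))); last first.
    by apply/seteqP; split => v /= Av i; [move=> _|]; exact: Av.
  apply: fin_bigcap_measurable; first exact: finite_finset.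
  by move=> i _; rewrite -[X in measurable X]setTI; exact: measurable_rV_coord.
rewrite /= /lebesgue_rV_step /pushforward /sf_product -product_measure1E //; last exact: mA.
congr (product_measure1 _ _ _); apply/seteqP; split => -[a v] /=.
  move=> Av; split; first by have := Av ord0; rewrite mxE unlift_none.
  by move=> i; have := Av (lift ord0 i); rewrite mxE liftK.
move=> [Aa Av] i; rewrite mxE.
by case: unliftP => [j ->|->]; [exact: Av|].
Qed.

(* Elements ((x, y), t) of H^n, so that p.1 is z = (x, y). *)
Notation heis R n := ('rV[R]_n * 'rV[R]_n * R)%type.

Definition heis_measure (R : realType) (n : nat) :
    {sigma_finite_measure
      set ('rV[R]_n * 'rV[R]_n * measurableTypeR R)%type -> \bar R} :=
  sf_product (sf_product (lebesgue_rV R n) (lebesgue_rV R n)) lebesgue_measure.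

Definition cube (R : realType) (n : nat) (r : R) :
    set ('rV[R]_n * 'rV[R]_n)%type :=
  [set z : 'rV[R]_n * 'rV[R]_n |
    forall j : 'I_n, `|z.1 ord0 j| <= r /\ `|z.2 ord0 j| <= r].

Arguments cube {R} n r.

Section sublaplacian.
Variables (R : realType) (n : nat).
Implicit Types (f phi : heis R n -> R) (p : heis R n).

Definition dx j : heis R n := ((delta_mx ord0 j, 0), 0).
Definition dy j : heis R n := ((0, delta_mx ord0 j), 0).
Definition dt : heis R n := ((0, 0), 1).

Definition X_field (j : 'I_n) f p : R :=
  'D_(dx j) f p + 2^-1 * p.1.2 ord0 j * 'D_dt f p.

Definition Y_field (j : 'I_n) f p : R :=
  'D_(dy j) f p - 2^-1 * p.1.1 ord0 j * 'D_dt f p.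

Definition sublaplacian f p : R :=
  \sum_(j < n) (X_field j (X_field j f) p + Y_field j (Y_field j f) p).

Definition iter_derive (vs : seq (heis R n)) f : heis R n -> R :=
  foldr (fun v g => 'D_v g) f vs.

Definition test_function phi : Prop :=
  (forall vs p, differentiable (iter_derive vs phi) p) /\
  compact (closure [set p | phi p != 0]).

End sublaplacian.

Section L2.
Variables (R : realType) (n : nat).
Implicit Types (u v w : heis R n -> R[i]).

Local Notation mu := (heis_measure R n).

Definition mass (A : set (heis R n)) u : \bar R :=
  (\int[mu]_(p in A) ((ComplexField.Normc.normc (u p)) ^+ 2)%:E)%E.

Definition L2 u : Prop :=
  [/\ measurable_fun setT (fun p => complex.Re (u p)),
      measurable_fun setT (fun p => complex.Im (u p)) &
      (mass setT u < +oo)%E].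

Definition cintegral u : R[i] :=
  Complex (\int[mu]_p complex.Re (u p)) (\int[mu]_p complex.Im (u p)).

(* The graph of the self-adjoint operator L on L^2(H^n): its domain is the set of
   the u in L^2 whose distributional image L u is in L^2. The formal transpose of L
   is L, and real test functions suffice since L has real coefficients. *)
Definition L2_sublaplacian u v : Prop :=
  [/\ L2 u, L2 v & forall phi, test_function phi ->
    cintegral (fun p => u p * (sublaplacian phi p)%:C%C) =
    cintegral (fun p => v p * (phi p)%:C%C)].

(* U is the strongly continuous one-parameter unitary group e^{isL} that Stone's
   theorem associates with L: its infinitesimal generator, with its domain, is iL.
   Elements of L^2 are represented by functions; that U s respects equality almost
   everywhere follows from linearity and isometry. *)
Record is_schrodinger_group (U : R -> (heis R n -> R[i]) -> heis R n -> R[i])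
    : Prop := {
  group_L2 : forall s u, L2 u -> L2 (U s u);
  group_linear : forall s (a : R[i]) u v, L2 u -> L2 v ->
    {ae mu, forall p, U s (fun q => a * u q + v q) p = a * U s u p + U s v p};
  group_isometry : forall s u, L2 u -> mass setT (U s u) = mass setT u;
  group_0 : forall u, L2 u -> {ae mu, forall p, U 0 u p = u p};
  group_D : forall s s' u, L2 u ->
    {ae mu, forall p, U (s + s') u p = U s (U s' u) p};
  group_continuous : forall u, L2 u ->
    mass setT (fun p => U h u p - u p) @[h --> (0 : R)] --> 0%E;
  group_generator : forall u v, L2 u -> L2 v ->
    (mass setT (fun p => (h^-1)%:C%C * (U h u p - u p) - 'i%C * v p)
       @[h --> (0 : R)^'] --> 0%E)
    <-> L2_sublaplacian u v
}.

End L2.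

(* Main.v *)
(* On the sector of central frequencies lambda > 0, the ground state
   e^(i lambda t - lambda |z|^2 / 4) of the sub-Laplacian has eigenvalue
   - n lambda, so that the Schrodinger group acts on superpositions of such states
   as the translation t -> t - n s along the center, which does not disperse in z.
   The superposition with weight lambda^(m - 1) e^(-lambda) is, up to a constant,
   (1 + |z|^2 / 4 - i t)^(-m), and as m grows it concentrates around z = 0, at
   both times s1 and s2.  Since e^(isL) is only known through its generator, the
   formula for the evolution is proved by checking that the explicit curve solves
   the equation in L^2 and invoking unitarity. *)

From HB Require Import structures.
Require Import Defs.
From mathcomp Require Import all_boot all_order all_algebra.
From mathcomp Require Import all_classical all_reals all_analysis.
From mathcomp Require Import measurable_realfun complex.
From mathcomp Require Import ring lra.

Import Order.TTheory GRing.Theory Num.Theory.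
Import numFieldNormedType.Exports.

Set Implicit Arguments.
Unset Strict Implicit.
Unset Printing Implicit Defensive.

Local Open Scope classical_set_scope.
Local Open Scope ring_scope.

(** * Measure-preserving translations *)

Section measure_preserving.
Local Open Scope ereal_scope.
Context {R : realType}.

(** Write a = 1 + |z|^2/4 - i t. The frequency integral is never computed: X_j a = zeta and Y_j a =
    i zeta with zeta = (x_j - i y_j)/2, so the terms in zeta^2 cancel in X_j^2 + Y_j^2, and L a^(-m)
    = - n m a^(-m-1) is i n times the t-derivative of a^(-m). As the domain of L is defined by
    duality with test functions, this identity has to be established weakly. Integration by parts is
    derived from the invariance of Lebesgue measure under Euclidean translations, and all domination
    goes through one product weight, integrable on R^(2n+1). The concentration is quantitative.
    Outside the cube |a| >= rho = 1 + r^2/4 whatever the translation along the center, so the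
    right-hand side decays at least like rho^(-2m); near the origin |a|^2 is at most some sigma <
    rho^2, so the left-hand side decays no faster than sigma^(-m). The first 2n + 1 powers of 1/a
    are set aside for integrability, one per coordinate. *)

Definition measure_preserving {d} {T : measurableType d}
    (mu : {measure set T -> \bar R}) (tau : T -> T) :=
  measurable_fun setT tau /\
  forall A, measurable A -> mu (tau @^-1` A) = mu A.

Lemma measure_preserving_ge0_integral d (T : measurableType d)
    (mu : {measure set T -> \bar R}) tau (f : T -> \bar R) :
  measure_preserving mu tau -> measurable_fun setT f -> (forall x, 0 <= f x) ->
  \int[mu]_x f (tau x) = \int[mu]_x f x.
Proof.
move=> [mtau tauE] mf f0.
have := @ge0_integral_pushforward _ _ T T R tau mtau mu setT f measurableT mf
  (fun y _ => f0 y).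
rewrite preimage_setT => <-; apply: eq_measure_integral => A mA _.
exact: tauE.
Qed.

Lemma measure_preserving_integral d (T : measurableType d)
    (mu : {measure set T -> \bar R}) tau (f : T -> \bar R) :
  measure_preserving mu tau -> measurable_fun setT f ->
  \int[mu]_x f (tau x) = \int[mu]_x f x.
Proof.
move=> tauP mf; rewrite [LHS]integralE [RHS]integralE.
have mfp : measurable_fun setT f^\+ by exact: measurable_funepos.
have mfn : measurable_fun setT f^\- by exact: measurable_funeneg.
rewrite -(measure_preserving_ge0_integral tauP mfp (funepos_ge0 f)).
rewrite -(measure_preserving_ge0_integral tauP mfn (funeneg_ge0 f)).
by congr (_ - _); apply: eq_integral => x _; rewrite !(funeposE, funenegE).
Qed.

Lemma measure_preserving_prod d1 d2 (T1 : measurableType d1)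
    (T2 : measurableType d2) (m1 : {sigma_finite_measure set T1 -> \bar R})
    (m2 : {sigma_finite_measure set T2 -> \bar R}) tau1 tau2 :
  measure_preserving m1 tau1 -> measure_preserving m2 tau2 ->
  measure_preserving (sf_product m1 m2) (fun p => (tau1 p.1, tau2 p.2)).
Proof.
move=> tau1P [mtau2 tau2E]; have [mtau1 tau1E] := tau1P; split.
  by apply: measurable_fun_pair;
    [exact: measurableT_comp mtau1 _|exact: measurableT_comp mtau2 _].
move=> A mA; rewrite /sf_product /product_measure1.
have m2A : measurable_fun setT (m2 \o xsection A).
  exact: measurable_fun_xsection.
have m2A0 x : 0 <= (m2 \o xsection A) x by exact: measure_ge0.
(* The section at [x] of the preimage of [A] is the [tau2]-preimage of the section of [A] at
   [tau1 x]. *)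
transitivity (\int[m1]_x (m2 \o xsection A) (tau1 x)); last first.
  exact: measure_preserving_ge0_integral.
apply: eq_integral => x _ /=; rewrite -(tau2E (xsection A (tau1 x)));
  last exact: measurable_xsection.
by congr (m2 _); apply/seteqP; split=> y /=; rewrite /xsection /= !inE.
Qed.

Lemma measure_preserving_shift (h : R) :
  measure_preserving (@lebesgue_measure R) (shift h).
Proof.
have mh : measurable_fun setT (shift h : measurableTypeR R -> measurableTypeR R).
  exact: measurable_funD.
split=> // A mA; apply/esym.
pose sh : measurableTypeR R -> measurableTypeR R := shift h.
rewrite -[RHS]/(pushforward lebesgue_measure sh A).
apply: lebesgue_measure_unique => //.
move=> X [[a b] _ <-] /=; rewrite /pushforward.
rewrite (_ : _ @^-1` _ = `](a - h)%R, (b - h)%R]%classic); last first.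
  by apply/seteqP; split => x /=; rewrite !in_itv/= ltrBlDr lerBrDr.
rewrite !lebesgue_measure_itv/= !lte_fin ltrD2r -!EFinD.
by case: ifP => // _; congr EFin; ring.
Qed.

Lemma measure_preserving_rV n (w : 'rV[R]_n) :
  measure_preserving (lebesgue_rV R n) (fun v => v + w)%R.
Proof.
have mw m (w' : 'rV[R]_m) : measurable_fun setT (fun v : 'rV[R]_m => v + w')%R.
  apply: measurable_fun_rVP => i.
  rewrite (_ : (fun _ => _) = (fun v : 'rV[R]_m => v ord0 i + w' ord0 i)%R); last first.
    by apply/funext => v; rewrite mxE.
  by apply: measurable_funD => //; exact: measurable_rV_coord.
split; first exact: mw.
elim: n w => [|n IHn] w A mA.
  have -> : (fun v : 'rV[R]_0 => (v + w)%R) = id by apply/funext => v; apply/rowP => -[].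
  by [].
rewrite /= /lebesgue_rV_step /pushforward.
(* [rV_cons] conjugates the translation by [w] to the product of the translations by its head and by
   its tail [w']. *)
set w' : 'rV[R]_n := \row_j w ord0 (lift ord0 j).
have [_ E] := measure_preserving_prod (measure_preserving_shift (w ord0 ord0))
    (conj (mw n w') (IHn w')).
have mB : measurable (@rV_cons R n @^-1` A).
  by rewrite -[X in measurable X]setTI; exact: measurable_rV_cons.
rewrite -(E _ mB); congr (sf_product _ _ _).
apply/funext => -[a v] /=; congr (A _).
apply/rowP => i; rewrite !mxE; case: unliftP => [j|] -> //.
by rewrite !mxE.
Qed.

(** Euclidean translations, not those of the group law: the derivatives ['D_v] are limits of
    Euclidean difference quotients. *)
Lemma measure_preserving_heis n (q : heis R n) :
  measure_preserving (heis_measure R n) (fun p => p + q)%R.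
Proof.
exact: (measure_preserving_prod (measure_preserving_prod
  (measure_preserving_rV q.1.1) (measure_preserving_rV q.1.2))
  (measure_preserving_shift q.2)).
Qed.

End measure_preserving.

(** * Measurability of continuous functions for the coordinate sigma-algebra *)

Section continuous_measurable_heis.
Context {R : realType} (n : nat).

Lemma cvg_mx {T : Type} {F : set_system T} {FF : Filter F} (V : topologicalType)
    m k (f : T -> 'M[V]_(m, k)) (M : 'M[V]_(m, k)) :
  (forall i j, f x i j @[x --> F] --> M i j) -> f @ F --> M.
Proof.
move=> fM A [P MP PA].
rewrite nbhs_filterE /=.
have H : \forall x \near F, forall ij : 'I_m * 'I_k, P ij.1 ij.2 (f x ij.1 ij.2).
  by apply: filter_forall => -[i j]; exact: fM (MP i j).
by apply: filterS H => x H; apply: PA => i j; exact: (H (i, j)).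
Qed.

Lemma measurable_heis_x i : measurable_fun setT (fun p : heis R n => p.1.1 ord0 i).
Proof.
apply: (measurableT_comp (@measurable_rV_coord _ _ _ i)).
exact: measurableT_comp measurable_fst measurable_fst.
Qed.

Lemma measurable_heis_y i : measurable_fun setT (fun p : heis R n => p.1.2 ord0 i).
Proof.
apply: (measurableT_comp (@measurable_rV_coord _ _ _ i)).
exact: measurableT_comp measurable_snd measurable_fst.
Qed.

Lemma measurable_heis_t : measurable_fun setT (fun p : heis R n => p.2).
Proof. exact: measurable_snd. Qed.

Let grid (x : R) (k : nat) : int := Num.floor (x * k.+1%:R).

Let cvg_grid (x : R) : (grid x k)%:~R / k.+1%:R @[k --> \oo] --> x.
Proof.
apply/cvgrPdist_lt => e e0.
near=> k.
have k0 : (0 : R) < k.+1%:R by rewrite ltr0n.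
have /andP[h1 h2] : (grid x k)%:~R <= x * k.+1%:R < (grid x k + 1)%:~R.
  by rewrite floor_itv.
have -> : x - (grid x k)%:~R / k.+1%:R = (x * k.+1%:R - (grid x k)%:~R) / k.+1%:R.
  by rewrite mulrBl mulfK ?pnatr_eq0.
rewrite intrD in h2.
rewrite ger0_norm; last by apply: divr_ge0; [rewrite subr_ge0|exact: ltW].
apply: (@lt_trans _ _ k.+1%:R^-1); last first.
  by near: k; exact: (near_infty_natSinv_lt (PosNum e0)).
rewrite ltr_pdivrMr// mulVf ?gt_eqF//; lra.
Unshelve. all: by end_near. Qed.

Let measurable_grid (k : nat) (c : int) :
  measurable [set x : measurableTypeR R | grid x k = c].
Proof.
have k0 : (0 : R) < k.+1%:R by rewrite ltr0n.
rewrite (_ : mkset _ = `[(c%:~R / k.+1%:R), ((c + 1)%:~R / k.+1%:R)[%classic).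
  exact: measurable_itv.
apply/seteqP; split => x /=; rewrite in_itv/= ler_pdivrMr// ltr_pdivlMr//.
  by move=> <-; rewrite floor_itv.
by rewrite -floor_eq// => /eqP.
Qed.

(** The sigma-algebra is generated by coordinates, continuity refers to the product topology;
    sampling links the two. The value of [f] at the lower corner of the grid cell of mesh 1/(k+1)
    containing [p] depends only on a countable index with measurable fibres, and it tends to [f p]
    by continuity. *)
Lemma continuous_measurable_heis (f : heis R n -> R) :
  continuous f -> measurable_fun setT f.
Proof.
move=> cf.
pose idx k (p : heis R n) : 'rV[int]_n * 'rV[int]_n * int :=
  (\row_i grid (p.1.1 ord0 i) k, \row_i grid (p.1.2 ord0 i) k, grid p.2 k).
pose q k (c : 'rV[int]_n * 'rV[int]_n * int) : heis R n :=
  (\row_i ((c.1.1 ord0 i)%:~R / k.+1%:R), \row_i ((c.1.2 ord0 i)%:~R / k.+1%:R),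
   c.2%:~R / k.+1%:R).
apply: (@measurable_fun_cvg _ _ _ _ (fun k p => f (q k (idx k p)))) => [k|p _].
- move=> _ B mB; rewrite setTI.
  rewrite (_ : _ @^-1` B = \bigcup_c [set p | B (f (q k c)) /\ idx k p = c]); last first.
    by apply/seteqP; split => [p /= Bp|p [c _ [Bc E]]]; [exists (idx k p)|rewrite /= E].
  apply: countable_bigcupT_measurable => // c.
  have [Bc|nBc] := pselect (B (f (q k c))); last first.
    by rewrite (_ : mkset _ = set0)//; apply/seteqP; split => // p [].
  rewrite (_ : mkset _ =
    (\bigcap_(i in [set: 'I_n]) ((fun p : heis R n => p.1.1 ord0 i) @^-1`
        [set x | grid x k = c.1.1 ord0 i]))
    `&` (\bigcap_(i in [set: 'I_n]) ((fun p : heis R n => p.1.2 ord0 i) @^-1`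
        [set x | grid x k = c.1.2 ord0 i]))
    `&` (snd @^-1` [set x | grid x k = c.2])); last first.
    apply/seteqP; split => p /=.
      by move=> [_ <-]; split; [split=> i _|] => /=; rewrite ?mxE.
    case=> -[p1 p2] p3; split => //; case: (c) p1 p2 p3 => -[c1 c2] c3 /= p1 p2 p3.
    by congr (_, _, _) => //; apply/rowP => i; rewrite !mxE; [exact: p1|exact: p2].
  apply: measurableI; first apply: measurableI.
  + apply: fin_bigcap_measurable; first exact: finite_finset.
    move=> i _; rewrite -[X in measurable X]setTI.
    exact: (@measurable_heis_x i measurableT _ (measurable_grid k (c.1.1 ord0 i))).
  + apply: fin_bigcap_measurable; first exact: finite_finset.
    move=> i _; rewrite -[X in measurable X]setTI.
    exact: (@measurable_heis_y i measurableT _ (measurable_grid k (c.1.2 ord0 i))).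
  + rewrite -[X in measurable X]setTI.
    exact: (measurable_heis_t measurableT (measurable_grid k c.2)).
- suff H : q k (idx k p) @[k --> \oo] --> p by exact: (cvg_comp _ _ H (cf p)).
  case: p => [[x y] t]; rewrite /q /idx /=.
  have H (v : 'rV[R]_n) :
      (\row_i ((grid (v ord0 i) k)%:~R / k.+1%:R) : 'rV[R]_n) @[k --> \oo] --> v.
    by apply: cvg_mx => i j; rewrite (ord1 i); under eq_fun do rewrite mxE;
      exact: cvg_grid.
  rewrite (_ : (fun k => _) = fun k =>
    ((\row_i ((grid (x ord0 i) k)%:~R / k.+1%:R) : 'rV[R]_n,
      \row_i ((grid (y ord0 i) k)%:~R / k.+1%:R) : 'rV[R]_n),
     (grid t k)%:~R / k.+1%:R)).
    exact: (cvg_pair (cvg_pair (H x) (H y)) (@cvg_grid t)).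
  apply/funext => k /=; congr (_, _, _); by apply/rowP => i; rewrite !mxE.
Qed.

End continuous_measurable_heis.

(** * An integrable weight *)

Section lorentz_weight.
Context {R : realType}.

(** Polynomial decay is chosen because a translation of length at most 1 then costs only a bounded
    factor ([lorentz_shift]), which a Gaussian would not allow. *)
Definition lorentz (x : R) : R := (1 + x ^+ 2)^-1.

Lemma lorentz_gt0 x : 0 < lorentz x.
Proof. by rewrite invr_gt0 ltr_pwDl// sqr_ge0. Qed.

Lemma lorentz_shift x s : `|s| <= 1 -> lorentz (x + s) <= 4 * lorentz x.
Proof.
rewrite ler_norml => /andP[s1 s2].
have h y : 0 < 1 + y ^+ 2 :> R by rewrite ltr_pwDl// sqr_ge0.
rewrite /lorentz -[_ * _^-1]invrK invfM invrK lef_pV2 ?posrE//; last first.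
  by rewrite mulr_gt0// invr_gt0.
rewrite mulrC ler_pdivrMr//.
have s3 : s ^+ 2 <= 1 by nra.
(* [4 * (1 + (x + s) ^+ 2) - (1 + x ^+ 2)] equals [(3 * x + 4 * s) ^+ 2 / 3 + 3 - 4 * s ^+ 2 /
   3]. *)
by have := sqr_ge0 (3 * x + 4 * s); nra.
Qed.

Lemma lorentz_le x M : `|x| <= M -> lorentz M <= lorentz x.
Proof.
move=> xM; rewrite lef_pV2 ?posrE ?ltr_pwDl// ?sqr_ge0//.
rewrite lerD2l -[x ^+ 2]real_normK ?num_real//.
by rewrite lerXn2r// nnegrE// (le_trans _ xM).
Qed.

Lemma continuous_lorentz : continuous lorentz.
Proof. exact: continuous_oneDsqrV. Qed.

Lemma measurable_lorentz : measurable_fun setT lorentz.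
Proof. apply: continuous_measurable_fun; exact: continuous_lorentz. Qed.

Local Open Scope ereal_scope.

Lemma integral_lorentz_lty : \int[@lebesgue_measure R]_x (lorentz x)%:E < +oo.
Proof.
rewrite ge0_symfun_integralT.
- by rewrite -set_itvcy integral0y_oneDsqr ltry.
- by move=> x; rewrite ltW// lorentz_gt0.
- exact: continuous_lorentz.
- by move=> x; rewrite /lorentz/= sqrrN.
Qed.

Lemma ge0_integral_prodM d1 d2 (T1 : measurableType d1) (T2 : measurableType d2)
    (m1 : {sigma_finite_measure set T1 -> \bar R})
    (m2 : {sigma_finite_measure set T2 -> \bar R}) (f1 : T1 -> R) (f2 : T2 -> R) :
  measurable_fun setT f1 -> measurable_fun setT f2 ->
  (forall x, 0 <= f1 x)%R -> (forall x, 0 <= f2 x)%R ->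
  \int[sf_product m1 m2]_p (f1 p.1 * f2 p.2)%:E =
  \int[m1]_x (f1 x)%:E * \int[m2]_x (f2 x)%:E.
Proof.
move=> mf1 mf2 f10 f20.
rewrite [LHS](@fubini_tonelli1 _ _ _ _ _ m1 m2) /fubini_F /=; last 2 first.
- apply/measurable_EFinP; apply: measurable_funM; exact: measurableT_comp.
- by move=> p; rewrite lee_fin mulr_ge0.
have mf1E : measurable_fun setT (EFin \o f1) by exact/measurable_EFinP.
have mf2E : measurable_fun setT (EFin \o f2) by exact/measurable_EFinP.
transitivity (\int[m1]_x ((f1 x)%:E * \int[m2]_y (f2 y)%:E)).
  apply: eq_integral => x _; rewrite -ge0_integralZl_EFin//.
  by move=> y _; rewrite lee_fin.
rewrite ge0_integralZr//; first by move=> y _; rewrite lee_fin.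
by apply: integral_ge0 => y _; rewrite lee_fin.
Qed.

Definition lorentz_rV n (v : 'rV[R]_n) : R := (\prod_(i < n) lorentz (v ord0 i))%R.

Lemma lorentz_rV_gt0 n (v : 'rV[R]_n) : (0 < lorentz_rV v)%R.
Proof. by apply: prodr_gt0 => i _; exact: lorentz_gt0. Qed.

Lemma measurable_lorentz_rV n : measurable_fun setT (@lorentz_rV n).
Proof.
apply: measurable_prod => i _; apply: (measurableT_comp measurable_lorentz).
exact: measurable_rV_coord.
Qed.

Lemma integral_lorentz_rV_lty n :
  \int[lebesgue_rV R n]_v (lorentz_rV v)%:E < +oo.
Proof.
elim: n => [|n IHn].
  rewrite integral_dirac//=; last by apply/measurable_EFinP; exact: measurable_lorentz_rV.
  by rewrite diracT mul1e ltry.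
rewrite /= /lebesgue_rV_step.
rewrite (@ge0_integral_pushforward _ _ _ _ R (@rV_cons R n)) //; last 3 first.
- exact: measurable_rV_cons.
- by apply/measurable_EFinP; exact: measurable_lorentz_rV.
- by move=> v _; rewrite lee_fin ltW// lorentz_rV_gt0.
under eq_integral => p _.
  rewrite /= /lorentz_rV big_ord_recl mxE unlift_none.
  under eq_bigr => i _ do rewrite mxE liftK.
  rewrite -/(lorentz_rV p.2); over.
rewrite preimage_setT /=.
rewrite (@ge0_integral_prodM _ _ _ _ (@lebesgue_measure R)
  (lebesgue_rV R n) lorentz (@lorentz_rV n)).
- by rewrite lte_mul_pinfty ?integral_ge0// ?ge0_fin_numE ?integral_ge0//;
   rewrite ?integral_lorentz_lty// => x _; rewrite lee_fin ltW// ?lorentz_gt0 ?lorentz_rV_gt0.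
- exact: measurable_lorentz.
- exact: measurable_lorentz_rV.
- by move=> x; rewrite ltW// lorentz_gt0.
- by move=> x; rewrite ltW// lorentz_rV_gt0.
Qed.

(** The common dominating function: multiples of it bound both the continuous functions with compact
    support and the squared moduli of the kernels. *)
Definition weight n (p : heis R n) : R :=
  (lorentz_rV p.1.1 * lorentz_rV p.1.2 * lorentz p.2)%R.

Lemma weight_gt0 n (p : heis R n) : (0 < weight p)%R.
Proof. by rewrite !mulr_gt0 ?lorentz_rV_gt0 ?lorentz_gt0. Qed.

Lemma measurable_weight n : measurable_fun setT (@weight n).
Proof.
apply: measurable_funM.
  apply: measurable_funM; apply: (measurableT_comp (@measurable_lorentz_rV n)).
    exact: measurableT_comp measurable_fst measurable_fst.
  exact: measurableT_comp measurable_snd measurable_fst.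
exact: measurableT_comp measurable_lorentz measurable_snd.
Qed.

Lemma integral_weight_lty n : \int[heis_measure R n]_p (weight p)%:E < +oo.
Proof.
have lr v : (0 <= @lorentz_rV n v)%R by rewrite ltW// lorentz_rV_gt0.
have l0 x : (0 <= lorentz x)%R by rewrite ltW// lorentz_gt0.
rewrite (@ge0_integral_prodM _ _ _ _ (sf_product (lebesgue_rV R n) (lebesgue_rV R n))
  (@lebesgue_measure R) (fun z => lorentz_rV z.1 * lorentz_rV z.2)%R lorentz)//.
- rewrite ge0_integral_prodM//; [|exact: measurable_lorentz_rV..].
  have h0 : 0 <= \int[lebesgue_rV R n]_v (lorentz_rV v)%:E.
    by apply: integral_ge0 => v _; rewrite lee_fin.
  have h : \int[lebesgue_rV R n]_v (lorentz_rV v)%:E \is a fin_num.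
    by rewrite ge0_fin_numE// integral_lorentz_rV_lty.
  by rewrite lte_mul_pinfty ?mule_ge0 ?fin_numM// integral_lorentz_lty.
- by apply: measurable_funM; apply: (measurableT_comp (@measurable_lorentz_rV n)).
- exact: measurable_lorentz.
- by move=> x; rewrite mulr_ge0.
Qed.

End lorentz_weight.

(** * Domination by the weight and vanishing of integrals of derivatives *)

Section weight_bounds.
Context {R : realType} (n : nat).
Implicit Types p q v : heis R n.

Lemma rV_coord_le_norm (v : 'rV[R]_n) i : `|v ord0 i| <= `|v|.
Proof.
rewrite [leRHS]/Num.norm /= mx_normrE.
exact: (le_bigmax _ (fun ij : 'I_1 * 'I_n => `|v ij.1 ij.2|) (ord0, i)).
Qed.

Lemma delta_mx_norm_le1 (j : 'I_n) : `|delta_mx ord0 j : 'rV[R]_n| <= 1.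
Proof.
rewrite [leLHS]/Num.norm /= mx_normrE; apply/bigmax_leP; split=> // -[i k] _ /=.
by rewrite mxE; case: (_ && _); rewrite ?normr1 ?normr0.
Qed.

Lemma dx_norm_le1 (j : 'I_n) : `|dx R j| <= 1.
Proof. by rewrite !prod_normE/= !normr0 !ge_max ler01 delta_mx_norm_le1. Qed.

Lemma dy_norm_le1 (j : 'I_n) : `|dy R j| <= 1.
Proof. by rewrite !prod_normE/= !normr0 !ge_max ler01 delta_mx_norm_le1. Qed.

Lemma dt_norm_le1 : `|dt R n : heis R n| <= 1.
Proof. by rewrite !prod_normE/= !normr0 normr1 !ge_max ler01 lexx. Qed.

Lemma lorentz_rV_shift (v w : 'rV[R]_n) : `|w| <= 1 ->
  lorentz_rV (v + w) <= 4 ^+ n * lorentz_rV v.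
Proof.
move=> w1; have <- : \prod_(i < n) (4 : R) = 4 ^+ n by rewrite prodr_const card_ord.
rewrite -big_split /=; apply: ler_prod => i _.
rewrite ltW ?lorentz_gt0//= mxE; apply: lorentz_shift.
exact: le_trans (rV_coord_le_norm _ _) w1.
Qed.

Definition weight_ratio : R := 4 ^+ n * 4 ^+ n * 4.

Lemma weight_ratio_ge0 : 0 <= weight_ratio.
Proof. by rewrite !mulr_ge0// exprn_ge0. Qed.

Lemma weight_shift p q : `|q| <= 1 -> weight (p + q) <= weight_ratio * weight p.
Proof.
rewrite !prod_normE !ge_max => /andP[/andP[q1 q2] q3].
rewrite /weight_ratio /weight.
have -> : 4 ^+ n * 4 ^+ n * 4 * (lorentz_rV p.1.1 * lorentz_rV p.1.2 * lorentz p.2)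
  = (4 ^+ n * lorentz_rV p.1.1) * (4 ^+ n * lorentz_rV p.1.2) * (4 * lorentz p.2).
  by ring.
have h (v : 'rV[R]_n) : 0 <= lorentz_rV v by rewrite ltW// lorentz_rV_gt0.
have k (x : R) : 0 <= lorentz x by rewrite ltW// lorentz_gt0.
by rewrite !ler_pM ?mulr_ge0 ?lorentz_rV_shift ?lorentz_shift.
Qed.

Lemma lorentz_rV_ge (v : 'rV[R]_n) M : `|v| <= M -> lorentz M ^+ n <= lorentz_rV v.
Proof.
move=> vM; have <- : \prod_(i < n) lorentz M = lorentz M ^+ n.
  by rewrite prodr_const card_ord.
apply: ler_prod => i _; rewrite ltW ?lorentz_gt0//=; apply: lorentz_le.
exact: le_trans (rV_coord_le_norm _ _) vM.
Qed.

Lemma weight_ge p M : `|p| <= M -> lorentz M ^+ n * lorentz M ^+ n * lorentz M <= weight p.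
Proof.
rewrite !prod_normE !ge_max => /andP[/andP[q1 q2] q3].
have h : 0 <= lorentz M by rewrite ltW// lorentz_gt0.
by rewrite /weight !ler_pM ?mulr_ge0 ?exprn_ge0 ?lorentz_rV_ge ?lorentz_le.
Qed.

Lemma compact_support_le_weight (K : set (heis R n)) (f : heis R n -> R) :
  compact K -> continuous f -> (forall p, ~ K p -> f p = 0) ->
  exists C, forall p, `|f p| <= C * weight p.
Proof.
move=> cK cf fK.
have [M [_ HM]] := compact_bounded cK.
have [B [_ HB]] := compact_bounded (continuous_compact (continuous_subspaceT cf) cK).
(* [compact_bounded] gives bounds by every number strictly above [M] and [B], hence the [+ 1]; the
   absolute value of [B] keeps the constant nonnegative. *)
pose M' := M + 1; pose w := lorentz M' ^+ n * lorentz M' ^+ n * lorentz M'.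
have w0 : 0 < w by rewrite !mulr_gt0 ?exprn_gt0 ?lorentz_gt0.
exists ((`|B| + 1) / w) => p.
have B0 : 0 <= (`|B| + 1) / w by rewrite divr_ge0 ?addr_ge0// ltW.
have [Kp|nKp] := pselect (K p); last first.
  by rewrite (fK _ nKp) normr0 mulr_ge0// ltW// weight_gt0.
apply: (@le_trans _ _ ((`|B| + 1) / w * w)); last first.
  by rewrite ler_wpM2l// weight_ge// HM// ltrDl.
rewrite divfK ?gt_eqF//; apply: (HB (`|B| + 1)); last by exists p.
by rewrite ltr_pwDr// ler_norm.
Qed.

Lemma integrable_le_weight (f : heis R n -> R) C :
  measurable_fun setT f -> (forall p, `|f p| <= C * weight p) ->
  (heis_measure R n).-integrable setT (EFin \o f).
Proof.
move=> mf fC.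
pose g : heis R n -> \bar R := (fun p => C%:E * (weight p)%:E)%E.
apply: (@le_integrable _ _ R (heis_measure R n) setT measurableT (EFin \o f) g).
- exact/measurable_EFinP.
- by move=> p _; rewrite /g -EFinM lee_fin (le_trans (fC p))// ler_norm.
- apply: integrableZl => //; apply/integrableP; split.
    apply/measurable_EFinP; exact: measurable_weight.
  under eq_integral => p _ do rewrite gee0_abs ?lee_fin ?(ltW (weight_gt0 _))//.
  exact: integral_weight_lty.
Qed.

Lemma is_derive_line (f : heis R n -> R) p v (s : R) :
  derivable f (p + s *: v) v ->
  is_derive s 1 (fun h : R => f (p + h *: v)) ('D_v f (p + s *: v)).
Proof.
move=> df.
suff E : (fun h : R => h^-1 *: (((fun h : R => f (p + h *: v)) \o shift s) (h *: 1)
                        - f (p + s *: v)))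
  = (fun h => h^-1 *: ((f \o shift (p + s *: v)) (h *: v) - f (p + s *: v))).
  by split; rewrite /derivable /derive /= E.
apply/funext => h /=; congr (_ *: (f _ - _)).
by rewrite [h *: 1]mulr1 scalerDl addrCA.
Qed.

(** Directional derivatives as limits of sequences, the form that measurability of limits and
    dominated convergence take. *)
Lemma derivable_line_quotient (f : heis R n -> R) p v : derivable f p v ->
  k.+1%:R * (f (p + k.+1%:R^-1 *: v) - f p) @[k --> \oo] --> 'D_v f p.
Proof.
move=> df.
have h : (k.+1%:R^-1 : R) @[k --> \oo] --> (0 : R)^'.
  move=> A A0.
  have : \forall k \near \oo, @harmonic R k != 0 -> A (harmonic k).
    exact: (@cvg_harmonic R _ A0).
  by apply: filterS => k; apply; rewrite /harmonic invr_eq0 pnatr_eq0.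
suff -> : (fun k => k.+1%:R * (f (p + k.+1%:R^-1 *: v) - f p)) =
    (fun h : R => h^-1 *: ((f \o shift p) (h *: v) - f p)) \o (fun k => k.+1%:R^-1).
  exact: cvg_comp h df.
by apply/funext => k; rewrite /= invrK [p + _]addrC.
Qed.

(* Translation invariance makes the difference quotients of [f] integrate to zero. *)
Lemma integral_derive0 (v : heis R n) (f : heis R n -> R) C :
  `|v| <= 1 -> measurable_fun setT f -> (forall p, derivable f p v) ->
  (forall p, `|f p| <= C * weight p) -> (forall p, `|'D_v f p| <= C * weight p) ->
  (heis_measure R n).-integrable setT (EFin \o 'D_v f) /\
  (\int[heis_measure R n]_p ('D_v f p)%:E = 0)%E.
Proof.
move=> v1 mf df fC dfC.
have C0 : 0 <= C by
  have := le_trans (normr_ge0 _) (fC 0); rewrite pmulr_lge0// weight_gt0.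
pose q k p : R := k.+1%:R * (f (p + k.+1%:R^-1 *: v) - f p).
have mq k : measurable_fun setT (q k).
  apply: measurable_funM => //; apply: measurable_funB => //.
  apply: (measurableT_comp mf); exact: (measure_preserving_heis _).1.
have qdf p : q^~ p @ \oo --> 'D_v f p by exact: derivable_line_quotient.
have mdf : measurable_fun setT ('D_v f) by apply: measurable_fun_cvg => // p _; exact: qdf.
have k0 k : (0 : R) < k.+1%:R^-1 by rewrite invr_gt0 ltr0n.
have kinv1 k : k.+1%:R^-1 <= 1 :> R.
  by rewrite invf_le1; [rewrite ler1n|rewrite ltr0n].
have line_continuous p : continuous (fun h : R => f (p + h *: v)).
  move=> h; apply: differentiable_continuous; apply/derivable1_diffP.
  exact: (@ex_derive _ _ _ _ _ _ _ (is_derive_line (df _))).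
(* The quotient is ['D_v f] at an intermediate point [p + c *: v] with [c < 1]; since
   [|c *: v| <= 1], [weight_shift] brings the bound back to [p], uniformly in [k]. *)
have qC k p : `|q k p| <= C * weight_ratio * weight p.
  have [c] := @MVT R (fun h : R => f (p + h *: v)) (fun h => 'D_v f (p + h *: v))
     0 k.+1%:R^-1 (k0 k) (fun h _ => is_derive_line (df _))
     (continuous_subspaceT (line_continuous p)).
  rewrite in_itv/= => /andP[c0 ck]; rewrite scale0r addr0 subr0 => E.
  rewrite /q E mulrCA divff ?pnatr_eq0// mulr1 (le_trans (dfC _))// -mulrA.
  rewrite ler_wpM2l// weight_shift// normrZ gtr0_norm//.
  by rewrite mulr_ile1 ?(ltW c0)// (le_trans (ltW ck)).
have intf : (heis_measure R n).-integrable setT (EFin \o f).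
  exact: integrable_le_weight mf fC.
have intq k : (\int[heis_measure R n]_p (q k p)%:E = 0)%E.
  pose fk p := f (p + k.+1%:R^-1 *: v).
  have mfk : measurable_fun setT fk.
    by apply: (measurableT_comp mf); exact: (measure_preserving_heis _).1.
  have intfk : (heis_measure R n).-integrable setT (EFin \o fk).
    apply: (@integrable_le_weight _ (C * weight_ratio)) => // p.
    rewrite (le_trans (fC _))// -mulrA ler_wpM2l// weight_shift// normrZ gtr0_norm//.
    by rewrite mulr_ile1 ?(ltW (k0 k))// kinv1.
  have E : (\int[heis_measure R n]_p (fk p)%:E = \int[heis_measure R n]_p (f p)%:E)%E.
    have mfE : measurable_fun setT (EFin \o f) by exact/measurable_EFinP.
    exact: (@measure_preserving_integral R _ _ (heis_measure R n) _ (EFin \o f)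
      (measure_preserving_heis (k.+1%:R^-1 *: v)) mfE).
  under eq_integral => p _ do rewrite EFinM EFinB.
  rewrite integralZl//; last exact: integrableB.
  rewrite integralB//.
  rewrite E subee ?mule0//; exact: integrable_fin_num.
have mqE k : measurable_fun setT (EFin \o q k) by exact/measurable_EFinP.
have mdfE : measurable_fun setT (EFin \o 'D_v f) by exact/measurable_EFinP.
have [] := @dominated_convergence _ _ _ (heis_measure R n) setT measurableT
  (fun k => EFin \o q k) (EFin \o 'D_v f)
  (EFin \o (fun p => C * weight_ratio * weight p)).
- exact: mqE.
- exact: mdfE.
- by apply: aeW => p _; apply: cvg_EFin; [exact: nearW|exact: qdf].
- apply: (@integrable_le_weight _ (C * weight_ratio)).
    by apply: measurable_funM => //; exact: measurable_weight.
  by move=> p; rewrite ger0_norm//; apply: mulr_ge0;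
    [exact: mulr_ge0 weight_ratio_ge0|exact/ltW/weight_gt0].
- by apply: aeW => p k _; rewrite /= lee_fin.
move=> idf _ cvgq; split => //; apply/esym.
have -> : (0 = limn (fun k => \int[heis_measure R n]_p (q k p)%:E))%E.
  by apply/esym/cvg_lim => //; under eq_fun do rewrite intq; exact: cvg_cst.
exact/cvg_lim.
Qed.

End weight_bounds.

(** * Integration by parts *)

Section integration_by_parts.
Context {R : realType} (n : nat).
Local Notation H := (heis R n).
Local Notation mu := (heis_measure R n).
Implicit Types (f g phi psi : H -> R) (v : H).

(** Only regularity along [v] is recorded; continuity of [f] is asked for separately. The derivative
    is a parameter, so that a closed formula for it is built up along with [f]. *)
Definition C1_along v f (f' : H -> R) :=
  continuous f' /\ forall p, is_derive p v f (f' p).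

Definition Cc (K : set H) f := continuous f /\ forall p, ~ K p -> f p = 0.

Lemma continuous_mul f g : continuous f -> continuous g ->
  continuous (fun p => f p * g p).
Proof. by move=> cf cg p; apply: cvgM; [exact: cf|exact: cg]. Qed.

Lemma continuous_add f g : continuous f -> continuous g ->
  continuous (fun p => f p + g p).
Proof. by move=> cf cg p; apply: cvgD; [exact: cf|exact: cg]. Qed.

Lemma Cc_mull K f g : continuous f -> Cc K g -> Cc K (fun p => f p * g p).
Proof.
by move=> cf [cg gK]; split; [exact: continuous_mul|move=> p /gK ->; rewrite mulr0].
Qed.

Lemma Cc_add K f g : Cc K f -> Cc K g -> Cc K (fun p => f p + g p).
Proof.
move=> [cf fK] [cg gK]; split; first exact: continuous_add.
by move=> p Kp; rewrite fK// gK// addr0.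
Qed.

(** Around a point of the open complement of [K], [f] is identically zero. The set [K] is thus kept
    through all differentiations. *)
Lemma Cc_derive K v f f' : closed K -> Cc K f -> C1_along v f f' -> Cc K f'.
Proof.
move=> clK [cf fK] [cf' ff']; split => // p Kp.
have [_ <-] := ff' p.
rewrite (@near_eq_derive _ _ _ f (cst 0) p v); first by rewrite derive_cst.
have : nbhs p (~` K) by apply: open_nbhs_nbhs; split => //; exact: closed_openC.
by apply: filterS => q /fK.
Qed.

Lemma Cc_integrable K f : compact K -> Cc K f -> mu.-integrable setT (EFin \o f).
Proof.
move=> cK [cf fK]; have [C fC] := compact_support_le_weight cK cf fK.
exact: integrable_le_weight (continuous_measurable_heis cf) fC.
Qed.

Lemma C1_alongM v f f' g g' : continuous f -> continuous g ->
  C1_along v f f' -> C1_along v g g' ->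
  C1_along v (fun p => f p * g p) (fun p => f p * g' p + f' p * g p).
Proof.
move=> cf cg [cf' df] [cg' dg]; split.
  by apply: continuous_add; exact: continuous_mul.
move=> p.
have D : is_derive p v (fun q => f q * g q) (f p *: g' p + g p *: f' p).
  exact: is_deriveM (df p) (dg p).
by rewrite [f' p * _]mulrC.
Qed.

Lemma C1_alongD v f f' g g' :
  C1_along v f f' -> C1_along v g g' ->
  C1_along v (fun p => f p + g p) (fun p => f' p + g' p).
Proof.
move=> [cf' df] [cg' dg]; split; first exact: continuous_add.
by move=> p; exact: is_deriveD (df p) (dg p).
Qed.

(** Product rule and [integral_derive0] for [f * g], which vanishes off [K] although [f] need
    not. *)
Lemma integral_by_parts_along K v f f' g g' : compact K -> closed K -> `|v| <= 1 ->
  continuous f -> Cc K g -> C1_along v f f' -> C1_along v g g' ->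
  \int[mu]_p (f p * g' p) = - \int[mu]_p (f' p * g p).
Proof.
move=> cK clK v1 cf gK ff' gg'.
have g'K := Cc_derive clK gK gg'.
have fg := C1_alongM cf gK.1 ff' gg'.
have fgK := Cc_mull cf gK.
have [C1 fgC1] := compact_support_le_weight cK fgK.1 fgK.2.
have fg'K := Cc_derive clK fgK fg.
have [C2 fgC2] := compact_support_le_weight cK fg'K.1 fg'K.2.
have dE p : 'D_v (fun p => f p * g p) p = f p * g' p + f' p * g p.
  by have [_ ->] := fg.2 p.
have [||||] := @integral_derive0 R n v (fun p => f p * g p) (Num.max C1 C2) v1.
- exact: (continuous_measurable_heis fgK.1).
- by move=> p; have [] := fg.2 p.
- move=> p; rewrite (le_trans (fgC1 p))// ler_wpM2r ?le_max ?lexx//.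
  exact/ltW/weight_gt0.
- move=> p; rewrite dE (le_trans (fgC2 p))// ler_wpM2r ?le_max ?lexx ?orbT//.
  exact/ltW/weight_gt0.
move=> _ I0.
apply/eqP; rewrite -addr_eq0 -RintegralD//.
- apply/eqP; rewrite -[RHS]/(fine 0%E) -I0 /Rintegral; congr fine.
  by apply: eq_integral => p _; rewrite dE.
- exact: Cc_integrable (Cc_mull cf g'K).
- exact: Cc_integrable (Cc_mull ff'.1 gK).
Qed.

(** The field [v + c * dt] has no divergence, [c] being constant along [t]; it is therefore formally
    skew-adjoint. The term in [t] is handled by attaching [c] to [f] before integrating by parts. *)
Lemma integral_by_parts_field K v c f fv ft g gv gt :
  compact K -> closed K -> `|v| <= 1 ->
  continuous c -> C1_along (dt R n) c (fun=> 0) ->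
  continuous f -> C1_along v f fv -> C1_along (dt R n) f ft ->
  Cc K g -> C1_along v g gv -> C1_along (dt R n) g gt ->
  \int[mu]_p (f p * (gv p + c p * gt p)) =
  - \int[mu]_p ((fv p + c p * ft p) * g p).
Proof.
move=> cK clK v1 cc ct cf fvP ftP gK gvP gtP.
have gvK := Cc_derive clK gK gvP; have gtK := Cc_derive clK gK gtP.
have I1 := integral_by_parts_along cK clK v1 cf gK fvP gvP.
have ccf := continuous_mul cc cf.
have I2 := integral_by_parts_along cK clK (dt_norm_le1 n) ccf gK
  (C1_alongM cc cf ct ftP) gtP.
have e1 p : f p * (gv p + c p * gt p) = f p * gv p + (c p * f p) * gt p.
  by ring.
under eq_Rintegral do rewrite e1.
rewrite RintegralD//; last 2 first.
- exact: Cc_integrable (Cc_mull cf gvK).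
- exact: Cc_integrable (Cc_mull ccf gtK).
rewrite I1 I2 -opprD -RintegralD//.
- by congr (- _); apply: eq_Rintegral => p _; ring.
- exact: Cc_integrable (Cc_mull fvP.1 gK).
- apply: Cc_integrable cK (Cc_mull _ gK).
  exact: (C1_alongM cc cf ct ftP).1.
Qed.

Lemma iter_derive_continuous phi vs : test_function phi ->
  continuous (iter_derive vs phi).
Proof. by move=> [dphi _] p; apply: differentiable_continuous; exact: dphi. Qed.

Lemma iter_derive_C1 phi vs v : test_function phi ->
  C1_along v (iter_derive vs phi) (iter_derive (v :: vs) phi).
Proof.
move=> tphi; split; first exact: iter_derive_continuous.
by move=> p; split => //; apply: diff_derivable; exact: tphi.1.
Qed.

Lemma test_function_Cc phi : test_function phi ->
  Cc (closure [set p | phi p != 0]) phi.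
Proof.
move=> tphi; split; first exact: (@iter_derive_continuous _ [::]).
move=> p Kp; apply/eqP; apply: contra_notT Kp => pn0.
exact: subset_closure.
Qed.

(** Both [X_field j] and [Y_field j] have the form [v + c * dt], with [c] equal to y_j/2 or -x_j/2
    and hence constant along [v] and [t]. Two integrations by parts move the square of the field
    from [phi] to [f], with [h] and [psi] the images of [f] and [phi] under the field; integrability
    is recorded so that the fields can be summed. *)
Lemma integral_by_parts_field2 v (c f : H -> R) fv ft h hv ht phi psi :
  test_function phi -> `|v| <= 1 ->
  continuous c -> C1_along v c (fun=> 0) -> C1_along (dt R n) c (fun=> 0) ->
  continuous f -> C1_along v f fv -> C1_along (dt R n) f ft ->
  (forall p, h p = fv p + c p * ft p) ->
  C1_along v h hv -> C1_along (dt R n) h ht ->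
  (forall p, psi p = 'D_v phi p + c p * 'D_(dt R n) phi p) ->
  mu.-integrable setT (fun p => (f p * ('D_v psi p + c p * 'D_(dt R n) psi p))%:E) /\
  \int[mu]_p (f p * ('D_v psi p + c p * 'D_(dt R n) psi p)) =
  \int[mu]_p ((hv p + c p * ht p) * phi p).
Proof.
move=> tphi v1 cc cv ct cf fvP ftP hE hvP htP psiE.
set K := closure [set p | phi p != 0].
have cK : compact K by have [_] := tphi.
have clK : closed K by exact: closed_closure.
have phiK : Cc K phi by exact: test_function_Cc.
have C vs := @iter_derive_continuous phi vs tphi.
have C1 vs w := @iter_derive_C1 phi vs w tphi.
have KvP := Cc_derive clK phiK (C1 [::] v).
have KtP := Cc_derive clK phiK (C1 [::] (dt R n)).
have psiK : Cc K psi.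
  rewrite (_ : psi = fun p => 'D_v phi p + c p * 'D_(dt R n) phi p).
    exact: Cc_add KvP (Cc_mull cc KtP).
  exact/funext.
have dpsi w : C1_along w c (fun=> 0) -> exists psi', C1_along w psi psi'.
  move=> cw.
  rewrite (_ : psi = fun p => 'D_v phi p + c p * 'D_(dt R n) phi p); last first.
    exact/funext.
  eexists; apply: C1_alongD; first exact: (C1 [:: v] w).
  exact: (C1_alongM cc (C [:: dt R n]) cw (C1 [:: dt R n] w)).
have [pv pvP] := dpsi _ cv; have [pt ptP] := dpsi _ ct.
have dv p : 'D_v psi p = pv p by have [_ ->] := pvP.2 p.
have dtE p : 'D_(dt R n) psi p = pt p by have [_ ->] := ptP.2 p.
have ch : continuous h.
  rewrite (_ : h = fun p => fv p + c p * ft p); last exact/funext.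
  by apply: continuous_add; [exact: fvP.1|exact: continuous_mul ftP.1].
have E : (fun p => f p * ('D_v psi p + c p * 'D_(dt R n) psi p)) =
         (fun p => f p * (pv p + c p * pt p)).
  by apply/funext => p; rewrite dv dtE.
split.
  rewrite -[X in mu.-integrable _ X]/(EFin \o
    (fun p => f p * ('D_v psi p + c p * 'D_(dt R n) psi p))) E.
  apply: Cc_integrable cK (Cc_mull cf _).
  apply: Cc_add (Cc_derive clK psiK pvP) _.
  exact: Cc_mull cc (Cc_derive clK psiK ptP).
rewrite E (integral_by_parts_field cK clK v1 cc ct cf fvP ftP psiK pvP ptP).
have -> : \int[mu]_p ((fv p + c p * ft p) * psi p) =
  \int[mu]_p (h p * ('D_v phi p + c p * 'D_(dt R n) phi p)).
  by apply: eq_Rintegral => p _; rewrite hE psiE.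
rewrite (integral_by_parts_field cK clK v1 cc ct ch hvP htP phiK
  (C1 [::] v) (C1 [::] (dt R n))).
by rewrite opprK.
Qed.

End integration_by_parts.

(** * Differential calculus for complex-valued functions *)

Section complex_derivative.
Context {R : realType} (n : nat).
Local Notation H := (heis R n).
Implicit Types (v : H) (u w : H -> R[i]) (f : H -> R).

Lemma ReM (x y : R[i]) :
  complex.Re (x * y) = complex.Re x * complex.Re y - complex.Im x * complex.Im y.
Proof. by case: x y => [a b] [c d]. Qed.

Lemma ImM (x y : R[i]) :
  complex.Im (x * y) = complex.Re x * complex.Im y + complex.Im x * complex.Re y.
Proof. by case: x y => [a b] [c d]. Qed.

Lemma ReD (x y : R[i]) : complex.Re (x + y) = complex.Re x + complex.Re y.
Proof. by case: x y => [a b] [c d]. Qed.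

Lemma ImD (x y : R[i]) : complex.Im (x + y) = complex.Im x + complex.Im y.
Proof. by case: x y => [a b] [c d]. Qed.

Definition ccont u := continuous (fun p => complex.Re (u p)) /\
  continuous (fun p => complex.Im (u p)).

Definition cC1_along v u u' :=
  C1_along v (fun p => complex.Re (u p)) (fun p => complex.Re (u' p)) /\
  C1_along v (fun p => complex.Im (u p)) (fun p => complex.Im (u' p)).

Lemma continuous_opp f : continuous f -> continuous (fun p => - f p).
Proof. by move=> cf p; apply: cvgN; exact: cf. Qed.

Lemma continuous_cst_heis (k : R) : continuous (fun _ : H => k).
Proof. by move=> p; exact: cvg_cst. Qed.

Lemma C1_alongN v f f' : C1_along v f f' -> C1_along v (fun p => - f p) (fun p => - f' p).
Proof.
move=> [cf' df]; split; first by move=> p; apply: cvgN; exact: cf'.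
by move=> p; exact: is_deriveN (df p).
Qed.

Lemma C1_along_cst v (c : R) : C1_along v (fun=> c) (fun=> 0).
Proof.
by split; [move=> p; exact: cvg_cst|move=> p; exact: is_derive_cst].
Qed.

Lemma C1_along_sum v (I : Type) (r : seq I) (F F' : I -> H -> R) :
  (forall i, C1_along v (F i) (F' i)) ->
  C1_along v (fun p => \sum_(i <- r) F i p) (fun p => \sum_(i <- r) F' i p).
Proof.
move=> FF'; elim: r => [|i r IHr].
  under eq_fun do rewrite big_nil; under [X in C1_along _ _ X]eq_fun do rewrite big_nil.
  exact: C1_along_cst.
under eq_fun do rewrite big_cons; under [X in C1_along _ _ X]eq_fun do rewrite big_cons.
exact: C1_alongD.
Qed.

Lemma continuous_sum (I : Type) (r : seq I) (F : I -> H -> R) :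
  (forall i, continuous (F i)) -> continuous (fun p => \sum_(i <- r) F i p).
Proof.
move=> cF; elim: r => [|i r IHr].
  by under eq_fun do rewrite big_nil; move=> p; exact: cvg_cst.
by under eq_fun do rewrite big_cons; exact: continuous_add.
Qed.

Lemma C1_alongV v f f' : (forall p, f p != 0) -> continuous f -> C1_along v f f' ->
  C1_along v (fun p => (f p)^-1) (fun p => - (f p) ^- 2 * f' p).
Proof.
move=> f0 cf [cf' df]; split.
  apply: continuous_mul => // p; apply: cvgN; apply: cvgV; first by rewrite expf_neq0.
  by rewrite !expr2; apply: cvgM; exact: cf.
move=> p; have [dfp <-] := df p.
by split; [exact: derivableV|rewrite deriveV].
Qed.

Lemma cC1_alongM v u u' w w' : ccont u -> ccont w ->
  cC1_along v u u' -> cC1_along v w w' ->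
  cC1_along v (fun p => u p * w p) (fun p => u p * w' p + u' p * w p).
Proof.
move=> [cru ciu] [crw ciw] [ru iu] [rw iw]; split.
  under eq_fun do rewrite ReM.
  under [X in C1_along _ _ X]eq_fun do rewrite ReD !ReM.
  have := C1_alongD (C1_alongM cru crw ru rw) (C1_alongN (C1_alongM ciu ciw iu iw)).
  by congr C1_along; apply/funext => p; ring.
under eq_fun do rewrite ImM.
under [X in C1_along _ _ X]eq_fun do rewrite ImD !ImM.
have := C1_alongD (C1_alongM cru ciw ru iw) (C1_alongM ciu crw iu rw).
by congr C1_along; apply/funext => p; ring.
Qed.

Lemma ccontM u w : ccont u -> ccont w -> ccont (fun p => u p * w p).
Proof.
move=> [cru ciu] [crw ciw]; split.
  under eq_fun do rewrite ReM.
  apply: continuous_add; first exact: continuous_mul.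
  by move=> p; apply: cvgN; exact: (continuous_mul ciu ciw).
by under eq_fun do rewrite ImM; apply: continuous_add; exact: continuous_mul.
Qed.

Lemma ccontD u w : ccont u -> ccont w -> ccont (fun p => u p + w p).
Proof.
move=> [cru ciu] [crw ciw]; split.
  by under eq_fun do rewrite ReD; exact: continuous_add.
by under eq_fun do rewrite ImD; exact: continuous_add.
Qed.

Lemma ccont_cst (c : R[i]) : ccont (fun=> c).
Proof. by split => p; exact: cvg_cst. Qed.

Lemma cC1_along_cst v (c : R[i]) : cC1_along v (fun=> c) (fun=> 0).
Proof. by split; exact: C1_along_cst. Qed.

Lemma ccontN u : ccont u -> ccont (fun p => - u p).
Proof.
by move=> cu; under eq_fun do rewrite -mulN1r; exact: ccontM (ccont_cst _) cu.
Qed.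

Lemma ccontX u m : ccont u -> ccont (fun p => u p ^+ m).
Proof.
move=> cu; elim: m => [|m IHm]; first exact: ccont_cst.
by under eq_fun do rewrite exprS; exact: ccontM.
Qed.

Lemma cC1_alongMl v (c : R[i]) u u' : ccont u -> cC1_along v u u' ->
  cC1_along v (fun p => c * u p) (fun p => c * u' p).
Proof.
move=> cu uu'; have := cC1_alongM (ccont_cst c) cu (cC1_along_cst v c) uu'.
by under [X in cC1_along _ _ X]eq_fun do rewrite mul0r addr0.
Qed.

(** The condition on the real part ensures [u p != 0] and is the one that [cayley] visibly
    satisfies, its real part being at least 1. *)
Lemma ccontV u : (forall p, complex.Re (u p) != 0) -> ccont u ->
  ccont (fun p => (u p)^-1).
Proof.
move=> u0 [cr ci].
pose N p := complex.Re (u p) ^+ 2 + complex.Im (u p) ^+ 2.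
have N0 p : N p != 0 by rewrite /N gt_eqF// ltr_pwDl ?sqr_ge0// exprn_even_gt0//= u0.
have cN : continuous N by apply: continuous_add; exact: continuous_mul.
have cNV : continuous (fun p => (N p)^-1).
  by move=> p; apply: cvgV => //; exact: cN.
split.
  rewrite (_ : (fun p => _) = fun p => complex.Re (u p) * (N p)^-1).
    exact: continuous_mul.
  by apply/funext => p; rewrite /N; case: (u p).
rewrite (_ : (fun p => _) = fun p => - (complex.Im (u p) * (N p)^-1)).
  exact: continuous_opp (continuous_mul ci cNV).
by apply/funext => p; rewrite /N; case: (u p).
Qed.

Lemma cC1_alongV v u u' : (forall p, complex.Re (u p) != 0) -> ccont u ->
  cC1_along v u u' ->
  cC1_along v (fun p => (u p)^-1) (fun p => - ((u p)^-1 ^+ 2 * u' p)).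
Proof.
move=> u0 [cr ci] [r i].
pose N p := complex.Re (u p) ^+ 2 + complex.Im (u p) ^+ 2.
have N0 p : N p != 0 by rewrite /N gt_eqF// ltr_pwDl ?sqr_ge0// exprn_even_gt0//= u0.
have cN : continuous N by apply: continuous_add; exact: continuous_mul.
have NV := C1_alongV N0 cN (C1_alongD (C1_alongM cr cr r r) (C1_alongM ci ci i i)).
have cNV : continuous (fun p => (N p)^-1).
  by move=> p; apply: cvgV => //; exact: cN.
have ReV p : complex.Re (u p)^-1 = complex.Re (u p) * (N p)^-1.
  by rewrite /N; case: (u p).
have ImV p : complex.Im (u p)^-1 = - (complex.Im (u p) * (N p)^-1).
  by rewrite /N; case: (u p).
split.
  have := C1_alongM cr cNV r NV.
  congr C1_along; apply/funext => p; first by rewrite ReV.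
  rewrite -[RHS]opprK -[in RHS](mul1r (- _)) expr2.
  move: (N0 p); rewrite /N; case: (u p) => a b /= ab0; case: (u' p) => c d /=.
  by field.
have := C1_alongN (C1_alongM ci cNV i NV).
congr C1_along; apply/funext => p; first by rewrite ImV.
rewrite expr2; move: (N0 p); rewrite /N; case: (u p) => a b /= ab0; case: (u' p) => c d /=.
by field.
Qed.

Lemma cC1_along_negX v u u' m : ccont (fun p => (u p)^-1) ->
  (forall p, complex.Re (u p) != 0) -> ccont u -> cC1_along v u u' ->
  cC1_along v (fun p => (u p)^-1 ^+ m) (fun p => - (m%:R * ((u p)^-1 ^+ m.+1 * u' p))).
Proof.
move=> cV u0 cu uu'; have dV := cC1_alongV u0 cu uu'.
elim: m => [|m IHm].
  have := cC1_along_cst v 1; congr cC1_along; apply/funext => p.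
  by rewrite mul0r oppr0.
under eq_fun do rewrite exprS.
have := cC1_alongM cV (ccontX m cV) dV IHm.
congr cC1_along; apply/funext => p.
by rewrite -natr1 !exprS; ring.
Qed.

Lemma is_derive_affine f v (d : R) p : (forall h, f (h *: v + p) = f p + h * d) ->
  is_derive p v f d.
Proof.
move=> fE; have : (fun h : R => h^-1 *: ((f \o shift p) (h *: v) - f p)) @ 0^' --> d.
  apply: cvg_near_cst; near=> h; rewrite /= fE addrAC subrr add0r.
  by rewrite [_ *: _]mulrA mulVf ?mul1r//; near: h; exact: nbhs_dnbhs_neq.
by move=> fd; split; [apply/cvg_ex; exists d|exact/cvg_lim].
Unshelve. all: by end_near. Qed.

Lemma continuous_heis_x i : continuous (fun p : H => p.1.1 ord0 i).
Proof.
move=> p; apply: (@continuous_comp _ _ _ (fun p : H => p.1.1)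
  (fun v : 'rV[R]_n => v ord0 i)).
  by apply: (@continuous_comp _ _ _ (fun p : H => p.1) fst); exact: cvg_fst.
exact: coord_continuous.
Qed.

Lemma continuous_heis_y i : continuous (fun p : H => p.1.2 ord0 i).
Proof.
move=> p; apply: (@continuous_comp _ _ _ (fun p : H => p.1.2)
  (fun v : 'rV[R]_n => v ord0 i)).
  by apply: (@continuous_comp _ _ _ (fun p : H => p.1) snd); [exact: cvg_fst|exact: cvg_snd].
exact: coord_continuous.
Qed.

Lemma continuous_heis_t : continuous (fun p : H => p.2).
Proof. by move=> p; exact: cvg_snd. Qed.

Lemma C1_along_x v i : C1_along v (fun p : H => p.1.1 ord0 i) (fun=> v.1.1 ord0 i).
Proof.
split; first by move=> p; exact: cvg_cst.
by move=> p; apply: is_derive_affine => h; rewrite /= !mxE addrC.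
Qed.

Lemma C1_along_y v i : C1_along v (fun p : H => p.1.2 ord0 i) (fun=> v.1.2 ord0 i).
Proof.
split; first by move=> p; exact: cvg_cst.
by move=> p; apply: is_derive_affine => h; rewrite /= !mxE addrC.
Qed.

Lemma C1_along_t v : C1_along v (fun p : H => p.2) (fun=> v.2).
Proof.
split; first by move=> p; exact: cvg_cst.
by move=> p; apply: is_derive_affine => h; rewrite /= addrC.
Qed.

End complex_derivative.

(** * The explicit solutions *)

Section kernel.
Context {R : realType} (n : nat).
Local Notation H := (heis R n).
Local Notation mu := (heis_measure R n).
Implicit Types (v p : H) (tau : R).

(** This is 1 + |z|^2/4 - i (t - tau), up to scaling the denominator of the Cayley transform from
    the Heisenberg group to the sphere. Its real part does not see [tau]. *)
Definition cayley tau p : R[i] :=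
  Complex (1 + \sum_(i < n) (p.1.1 ord0 i ^+ 2 + p.1.2 ord0 i ^+ 2) / 4) (tau - p.2).

(* The translate by [tau] along the center of (1 + |z|^2/4 - i t)^(-m). *)
Definition kern tau m p : R[i] := (cayley tau p)^-1 ^+ m.

Lemma Re_cayley_ge1 tau p : 1 <= complex.Re (cayley tau p).
Proof.
rewrite lerDl; apply: sumr_ge0 => i _.
by rewrite divr_ge0// addr_ge0// sqr_ge0.
Qed.

Lemma Re_cayley_neq0 tau p : complex.Re (cayley tau p) != 0.
Proof. by rewrite gt_eqF// (lt_le_trans ltr01)// Re_cayley_ge1. Qed.

Lemma cayley_neq0 tau p : cayley tau p != 0.
Proof. by rewrite eq_complex negb_and Re_cayley_neq0. Qed.

Lemma ccont_cayley tau : ccont (cayley tau).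
Proof.
split; rewrite /cayley /=.
  apply: continuous_add; first by move=> p; exact: cvg_cst.
  apply: continuous_sum => i; apply: continuous_mul; last by move=> p; exact: cvg_cst.
  by apply: continuous_add; apply: continuous_mul;
    first [exact: continuous_heis_x|exact: continuous_heis_y].
apply: continuous_add; first by move=> p; exact: cvg_cst.
by move=> p; apply: cvgN; exact: continuous_heis_t.
Qed.

Lemma cC1_along_cayley tau v : cC1_along v (cayley tau) (fun p =>
  Complex (\sum_(i < n) (p.1.1 ord0 i * v.1.1 ord0 i + p.1.2 ord0 i * v.1.2 ord0 i) / 2)
    (- v.2)).
Proof.
split; rewrite /cayley /=; last first.
  have := C1_alongD (C1_along_cst v tau) (C1_alongN (C1_along_t v)).
  by under [X in C1_along _ _ X]eq_fun do rewrite add0r.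
have S i := C1_alongM
  (continuous_add (continuous_mul (@continuous_heis_x R n i) (@continuous_heis_x R n i))
               (continuous_mul (@continuous_heis_y R n i) (@continuous_heis_y R n i)))
  (@continuous_cst_heis R n 4^-1)
  (C1_alongD (C1_alongM (@continuous_heis_x R n i) (@continuous_heis_x R n i)
     (C1_along_x v i) (C1_along_x v i))
             (C1_alongM (@continuous_heis_y R n i) (@continuous_heis_y R n i)
     (C1_along_y v i) (C1_along_y v i)))
  (C1_along_cst v (4^-1 : R)).
have := C1_alongD (C1_along_cst v 1) (C1_along_sum (index_enum 'I_n) S).
congr C1_along; apply/funext => p; rewrite add0r; apply: eq_bigr => i _.
by field.
Qed.

(** [X_j] maps [cayley] to [zeta j] ([zeta_dx]) and [Y_j] maps it to i times [zeta j] ([zeta_dy]):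
    [cayley] is annihilated by X_j + i Y_j, a Cauchy-Riemann equation. *)
Definition zeta (j : 'I_n) p : R[i] :=
  Complex (p.1.1 ord0 j / 2) (- (p.1.2 ord0 j / 2)).

Lemma ccont_zeta j : ccont (zeta j).
Proof.
split; rewrite /zeta /=.
  by apply: continuous_mul; [exact: continuous_heis_x|move=> p; exact: cvg_cst].
move=> p; apply: cvgN.
apply: (continuous_mul (f := fun p : H => p.1.2 ord0 j)).
  exact: continuous_heis_y.
by move=> ?; exact: cvg_cst.
Qed.

Lemma cC1_along_zeta v j : cC1_along v (zeta j)
  (fun=> Complex (v.1.1 ord0 j / 2) (- (v.1.2 ord0 j / 2))).
Proof.
have c2 : continuous (fun p : H => 2^-1 : R) by move=> ?; exact: cvg_cst.
split; rewrite /zeta /=.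
  have := C1_alongM (@continuous_heis_x R n j) c2
    (C1_along_x v j) (C1_along_cst v (2^-1 : R)).
  by congr C1_along; apply/funext => p; rewrite mulr0 add0r.
have := C1_alongN (C1_alongM (@continuous_heis_y R n j) c2
  (C1_along_y v j) (C1_along_cst v (2^-1 : R))).
by congr C1_along; apply/funext => p; rewrite mulr0 add0r.
Qed.

Lemma ccont_kern tau m : ccont (kern tau m).
Proof.
by apply/ccontX/ccontV; [exact: Re_cayley_neq0|exact: ccont_cayley].
Qed.

Lemma cC1_along_kern tau m v a' : cC1_along v (cayley tau) a' ->
  cC1_along v (kern tau m) (fun p => - (m%:R * (kern tau m.+1 p * a' p))).
Proof.
move=> da; apply: cC1_along_negX da; [|exact: Re_cayley_neq0|exact: ccont_cayley].
exact: ccontV (Re_cayley_neq0 tau) (ccont_cayley tau).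
Qed.

Lemma cC1_along_cayley_dx tau j : cC1_along (dx R j) (cayley tau)
  (fun p => Complex (p.1.1 ord0 j / 2) 0).
Proof.
have := cC1_along_cayley tau (dx R j); congr cC1_along; apply/funext => p /=.
rewrite (bigD1 j)//= big1 ?addr0 ?oppr0.
  by rewrite !mxE !eqxx mulr1 mulr0 addr0.
by move=> i /negPf ij; rewrite !mxE ij andbF !mulr0 addr0 mul0r.
Qed.

Lemma cC1_along_cayley_dy tau j : cC1_along (dy R j) (cayley tau)
  (fun p => Complex (p.1.2 ord0 j / 2) 0).
Proof.
have := cC1_along_cayley tau (dy R j); congr cC1_along; apply/funext => p /=.
rewrite (bigD1 j)//= big1 ?addr0 ?oppr0.
  by rewrite !mxE !eqxx mulr1 mulr0 add0r.
by move=> i /negPf ij; rewrite !mxE ij andbF !mulr0 addr0 mul0r.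
Qed.

Lemma cC1_along_cayley_dt tau : cC1_along (dt R n) (cayley tau)
  (fun p => Complex 0 (- 1)).
Proof.
have := cC1_along_cayley tau (dt R n); congr cC1_along; apply/funext => p /=.
by rewrite big1// => i _; rewrite !mxE !mulr0 addr0 mul0r.
Qed.

Lemma cC1_along_zeta_dx j : cC1_along (dx R j) (zeta j) (fun=> Complex 2^-1 0).
Proof.
have := cC1_along_zeta (dx R j) j; congr cC1_along; apply/funext => p /=.
by rewrite !mxE !eqxx mul0r oppr0 mul1r.
Qed.

Lemma cC1_along_zeta_dy j : cC1_along (dy R j) (zeta j) (fun=> Complex 0 (- 2^-1)).
Proof.
have := cC1_along_zeta (dy R j) j; congr cC1_along; apply/funext => p /=.
by rewrite !mxE !eqxx mul0r mul1r.
Qed.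

Lemma cC1_along_zeta_dt j : cC1_along (dt R n) (zeta j) (fun=> 0).
Proof.
have := cC1_along_zeta (dt R n) j; congr cC1_along; apply/funext => p /=.
by rewrite !mxE mul0r oppr0.
Qed.

Lemma zeta_dx j p : zeta j p =
  Complex (p.1.1 ord0 j / 2) 0 + (2^-1 * p.1.2 ord0 j)%:C%C * Complex 0 (-1).
Proof. by apply/eqP; rewrite eq_complex /=; apply/andP; split; apply/eqP; ring. Qed.

Lemma zeta_dy j p : Complex 0 1 * zeta j p =
  Complex (p.1.2 ord0 j / 2) 0 + (- (2^-1 * p.1.1 ord0 j))%:C%C * Complex 0 (-1).
Proof. by apply/eqP; rewrite eq_complex /=; apply/andP; split; apply/eqP; ring. Qed.

Lemma complexV2 : Complex 2^-1 0 = 2^-1 :> R[i].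
Proof. by rewrite -[LHS]/((2^-1)%:C%C) fmorphV rmorph_nat. Qed.

(** The images of [kern tau m] under [X_j] and [Y_j] are multiples of [kern tau m.+1 * zeta j]; this
    provides the second differentiation. *)
Lemma cC1_along_kernM_zeta tau m j (k : R[i]) v a' z' :
  cC1_along v (cayley tau) a' -> cC1_along v (zeta j) z' ->
  cC1_along v (fun p => k * (kern tau m p * zeta j p))
   (fun p => k * (kern tau m p * z' p - m%:R * (kern tau m.+1 p * a' p) * zeta j p)).
Proof.
move=> da dz.
have := cC1_alongMl k (ccontM (ccont_kern tau m) (ccont_zeta j))
  (cC1_alongM (ccont_kern tau m) (ccont_zeta j) (cC1_along_kern m da) dz).
by congr cC1_along; apply/funext => p; rewrite mulNr.
Qed.

End kernel.

(* [rho] stands for the real or the imaginary part. *)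
Section weak_sublaplacian_kernel.
Context {R : realType} (n : nat).
Local Notation H := (heis R n).
Local Notation mu := (heis_measure R n).
Implicit Types (v p : H) (tau : R) (u : H -> R[i]) (phi : H -> R).
Variable rho : R[i] -> R.
Hypothesis rhoD : forall x y, rho (x + y) = rho x + rho y.
Hypothesis rhoZ : forall (r : R) x, rho (r%:C%C * x) = r * rho x.
Hypothesis rho_cont : forall u, ccont u -> continuous (fun p : H => rho (u p)).
Hypothesis rho_C1 : forall v u u', cC1_along v u u' ->
  C1_along v (fun p => rho (u p)) (fun p => rho (u' p)).

Lemma weak_field2 v (c : H -> R) u uv ut h hv ht phi psi :
  test_function phi -> `|v| <= 1 ->
  continuous c -> C1_along v c (fun=> 0) -> C1_along (dt R n) c (fun=> 0) ->
  ccont u -> cC1_along v u uv -> cC1_along (dt R n) u ut ->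
  (forall p, h p = uv p + (c p)%:C%C * ut p) ->
  cC1_along v h hv -> cC1_along (dt R n) h ht ->
  (forall p, psi p = 'D_v phi p + c p * 'D_(dt R n) phi p) ->
  mu.-integrable setT
    (fun p => (rho (u p) * ('D_v psi p + c p * 'D_(dt R n) psi p))%:E) /\
  \int[mu]_p (rho (u p) * ('D_v psi p + c p * 'D_(dt R n) psi p)) =
  \int[mu]_p (rho (hv p + (c p)%:C%C * ht p) * phi p).
Proof.
move=> tphi v1 cc cv ct cu uvP utP hE hvP htP psiE.
have hE' p : rho (h p) = rho (uv p) + c p * rho (ut p) by rewrite hE rhoD rhoZ.
have [i1 ->] := integral_by_parts_field2 tphi v1 cc cv ct (rho_cont cu) (rho_C1 uvP)
  (rho_C1 utP) hE' (rho_C1 hvP) (rho_C1 htP) psiE.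
by split => //; apply: eq_Rintegral => p _; rewrite rhoD rhoZ.
Qed.

Lemma weak_X_field2 tau m j phi : test_function phi ->
  mu.-integrable setT
    (fun p => (rho (kern tau m p) * X_field j (X_field j phi) p)%:E) /\
  \int[mu]_p (rho (kern tau m p) * X_field j (X_field j phi) p) =
  \int[mu]_p (rho (m%:R * m.+1%:R * (kern tau m.+2 p * zeta j p ^+ 2)
               - m%:R / 2 * kern tau m.+1 p) * phi p).
Proof.
move=> tphi.
pose c p : R := 2^-1 * p.1.2 ord0 j.
have c2 : continuous (fun p : H => 2^-1 : R) by move=> ?; exact: cvg_cst.
have cc : continuous c by apply: continuous_mul => //; exact: continuous_heis_y.
have cd (w : H) : w.1.2 ord0 j = 0 -> C1_along w c (fun=> 0).
  move=> w0.
  have := C1_alongM c2 (@continuous_heis_y R n j)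
    (C1_along_cst w (2^-1 : R)) (C1_along_y w j).
  by congr C1_along; apply/funext => p; rewrite w0 mulr0 mul0r addr0.
have kx := cC1_along_kern m (cC1_along_cayley_dx tau j).
have kt := cC1_along_kern m (cC1_along_cayley_dt n tau).
(* The image of [kern tau m] under [X_j] is [- m%:R * (kern tau m.+1 * zeta j)]; it is
   differentiated along [dx] and along [dt]. *)
have hx := cC1_along_kernM_zeta m.+1 (- m%:R) (cC1_along_cayley_dx tau j)
  (cC1_along_zeta_dx j).
have ht := cC1_along_kernM_zeta m.+1 (- m%:R) (cC1_along_cayley_dt n tau)
  (cC1_along_zeta_dt j).
have [||p||i1 i2] := weak_field2 tphi (dx_norm_le1 j) cc _ _
  (@ccont_kern R n tau m) kx kt _ hx ht
  (psi := X_field j phi).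
- by apply: cd; rewrite mxE.
- by apply: cd; rewrite mxE.
- by rewrite zeta_dx /c; ring.
- by [].
split; first exact: i1.
rewrite [LHS]i2; apply: eq_Rintegral => p _; congr (rho _ * _).
(* The [dx]-derivative of [cayley] is written as [zeta j] minus the [dt]-contribution, which then
   cancels against the term with coefficient [c]. *)
have -> : Complex (p.1.1 ord0 j / 2) 0 = zeta j p - (c p)%:C%C * Complex 0 (-1).
  by rewrite zeta_dx addrK.
by rewrite complexV2; field.
Qed.

Lemma weak_Y_field2 tau m j phi : test_function phi ->
  mu.-integrable setT
    (fun p => (rho (kern tau m p) * Y_field j (Y_field j phi) p)%:E) /\
  \int[mu]_p (rho (kern tau m p) * Y_field j (Y_field j phi) p) =
  \int[mu]_p (rho (- (m%:R * m.+1%:R * (kern tau m.+2 p * zeta j p ^+ 2))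
               - m%:R / 2 * kern tau m.+1 p) * phi p).
Proof.
move=> tphi.
pose c p : R := - (2^-1 * p.1.1 ord0 j).
have c2 := @continuous_cst_heis R n 2^-1.
have cc : continuous c.
  exact: continuous_opp (continuous_mul c2 (@continuous_heis_x R n j)).
have cd (w : H) : w.1.1 ord0 j = 0 -> C1_along w c (fun=> 0).
  move=> w0.
  have := C1_alongN (C1_alongM c2 (@continuous_heis_x R n j)
    (C1_along_cst w (2^-1 : R)) (C1_along_x w j)).
  by congr C1_along; apply/funext => p; rewrite w0 mulr0 mul0r addr0 oppr0.
have kx := cC1_along_kern m (cC1_along_cayley_dy tau j).
have kt := cC1_along_kern m (cC1_along_cayley_dt n tau).
have hx := cC1_along_kernM_zeta m.+1 (- (m%:R * Complex 0 1)) (cC1_along_cayley_dy tau j)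
  (cC1_along_zeta_dy j).
have ht := cC1_along_kernM_zeta m.+1 (- (m%:R * Complex 0 1)) (cC1_along_cayley_dt n tau)
  (cC1_along_zeta_dt j).
have YE f p : Y_field j f p = 'D_(dy R j) f p + c p * 'D_(dt R n) f p.
  by rewrite /Y_field mulNr.
have [||p||i1 i2] := weak_field2 tphi (dy_norm_le1 j) cc _ _
  (@ccont_kern R n tau m) kx kt _ hx ht
  (psi := Y_field j phi).
- by apply: cd; rewrite mxE.
- by apply: cd; rewrite mxE.
- transitivity (- (m%:R * (kern tau m.+1 p * (Complex 0 1 * zeta j p)))); first by ring.
  by rewrite zeta_dy /c; ring.
- exact: YE.
split; first by under eq_fun do rewrite YE.
under eq_Rintegral do rewrite YE.
rewrite [LHS]i2; apply: eq_Rintegral => p _; congr (rho _ * _).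
have -> : Complex (p.1.2 ord0 j / 2) 0 =
    Complex 0 1 * zeta j p - (c p)%:C%C * Complex 0 (-1).
  by rewrite zeta_dy addrK.
have -> : Complex 0 (- 2^-1) = - (Complex 0 1 * 2^-1) :> R[i].
  rewrite -complexV2; apply/eqP; rewrite eq_complex /=.
  by apply/andP; split; apply/eqP; ring.
(* To [field] the imaginary unit is an atom, so its square is isolated first and replaced by -1
   afterwards; this sign is the difference with [X_j]. *)
transitivity ((Complex 0 1 * Complex 0 1) *
   (m%:R * m.+1%:R * (kern tau m.+2 p * zeta j p ^+ 2) + m%:R / 2 * kern tau m.+1 p)).
  by field.
have -> : Complex 0 1 * Complex 0 1 = - 1 :> R[i].
  by apply/eqP; rewrite eq_complex /=; apply/andP; split; apply/eqP; ring.
by ring.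
Qed.

Lemma Rintegral_sum (r : seq 'I_n) (F : 'I_n -> H -> R) :
  (forall i, mu.-integrable setT (EFin \o F i)) ->
  mu.-integrable setT (EFin \o (fun p => \sum_(i <- r) F i p)) /\
  \int[mu]_p (\sum_(i <- r) F i p) = \sum_(i <- r) \int[mu]_p F i p.
Proof.
move=> iF; elim: r => [|i r [IH1 IH2]].
  have -> : (fun p => \sum_(i <- [::]) F i p) = fun=> 0.
    by apply/funext => p; rewrite big_nil.
  by split; [exact: integrable0|rewrite big_nil /Rintegral integral0].
have -> : (fun p => \sum_(i <- i :: r) F i p) = fun p => F i p + \sum_(i <- r) F i p.
  by apply/funext => p; rewrite big_cons.
split; first exact: (integrableD measurableT (iF i) IH1).
by rewrite big_cons RintegralD// IH2.
Qed.

(** The factor [- (n%:R * m%:R * kern tau m.+1 p)] is -i n times the derivative of [kern] in [tau],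
    so that in s the curve [kern (n%:R * s) m] formally solves the Schrodinger equation. *)
Lemma weak_kern tau m phi : test_function phi ->
  \int[mu]_p (rho (kern tau m p) * sublaplacian phi p) =
  \int[mu]_p (rho (- (n%:R * m%:R * kern tau m.+1 p)) * phi p).
Proof.
move=> tphi.
have phiK := test_function_Cc tphi; have [_ cK] := tphi.
have ck k := @ccont_kern R n tau k.
have cconst k : ccont (fun _ : H => k : R[i]) by exact: ccont_cst.
have czz j : ccont (fun p : H => zeta j p ^+ 2) by apply: ccontX; exact: ccont_zeta.
have int u : ccont u -> mu.-integrable setT (EFin \o (fun p => rho (u p) * phi p)).
  by move=> cu; exact: Cc_integrable cK (Cc_mull (rho_cont cu) phiK).
(* Independent of [j]: once the terms in [zeta j ^+ 2] from [X_j] and [Y_j] have cancelled, each of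
   the [n] pairs contributes this same integral. *)
pose I1 := \int[mu]_p (rho (- (m%:R * kern tau m.+1 p)) * phi p).
have E j : mu.-integrable setT (EFin \o (fun p => rho (kern tau m p) *
      (X_field j (X_field j phi) p + Y_field j (Y_field j phi) p))) /\
    \int[mu]_p (rho (kern tau m p) *
      (X_field j (X_field j phi) p + Y_field j (Y_field j phi) p)) = I1.
  have [iX X] := weak_X_field2 tau m j tphi.
  have [iY Y] := weak_Y_field2 tau m j tphi.
  have -> : (fun p => rho (kern tau m p) *
      (X_field j (X_field j phi) p + Y_field j (Y_field j phi) p)) =
      (fun p => rho (kern tau m p) * X_field j (X_field j phi) p +
      rho (kern tau m p) * Y_field j (Y_field j phi) p).
    by apply/funext => p; exact: mulrDr.
  split; first exact: (integrableD measurableT iX iY).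
  rewrite RintegralD// X Y -RintegralD//.
  - by apply: eq_Rintegral => p _; rewrite -mulrDl -rhoD; congr (rho _ * _); field.
  - apply: int; apply: ccontD; last by apply: ccontN; exact: ccontM.
    by apply: ccontM => //; exact: ccontM.
  - apply: int; apply: ccontD; last by apply: ccontN; exact: ccontM.
    by apply: ccontN; apply: ccontM => //; exact: ccontM.
under eq_Rintegral do rewrite mulr_sumr.
rewrite (Rintegral_sum _ (fun j => (E j).1)).2.
under eq_bigr do rewrite (E _).2.
have iI : mu.-integrable setT
    (EFin \o (fun p => rho (- (m%:R * kern tau m.+1 p)) * phi p)).
  by apply: int; apply: ccontN; exact: ccontM.
rewrite sumr_const card_ord -[I1 *+ n]mulr_natl.
rewrite -[LHS](@RintegralZl _ _ _ mu setT _ n%:R measurableT iI).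
apply: eq_Rintegral => p _; rewrite mulrA -rhoZ; congr (rho _ * _).
by rewrite rmorph_nat; ring.
Qed.

End weak_sublaplacian_kernel.

(** * Norms in L^2 *)

Section L2_norm.
Context {R : realType} (n : nat).
Local Notation H := (heis R n).
Local Notation mu := (heis_measure R n).
Local Notation normc := ComplexField.Normc.normc.
Implicit Types (u w : H -> R[i]).

Definition cmeasurable u :=
  measurable_fun setT (fun p => complex.Re (u p)) /\
  measurable_fun setT (fun p => complex.Im (u p)).

Lemma L2_cmeasurable u : L2 u -> cmeasurable u.
Proof. by case. Qed.

Lemma cmeasurableM u w : cmeasurable u -> cmeasurable w ->
  cmeasurable (fun p => u p * w p).
Proof.
move=> [ru iu] [rw iw]; split.
  under eq_fun do rewrite ReM.
  by apply: measurable_funB; exact: measurable_funM.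
under eq_fun do rewrite ImM.
by apply: measurable_funD; exact: measurable_funM.
Qed.

Lemma cmeasurableD u w : cmeasurable u -> cmeasurable w ->
  cmeasurable (fun p => u p + w p).
Proof.
move=> [ru iu] [rw iw]; split.
  by under eq_fun do rewrite ReD; exact: measurable_funD.
by under eq_fun do rewrite ImD; exact: measurable_funD.
Qed.

Lemma cmeasurable_cst (c : R[i]) : cmeasurable (fun=> c).
Proof. by split; exact: measurable_cst. Qed.

Lemma ccont_cmeasurable u : ccont u -> cmeasurable u.
Proof. by case=> cr ci; split; exact: continuous_measurable_heis. Qed.

Lemma normc_ge0 (x : R[i]) : 0 <= normc x.
Proof. by case: x => a b /=; exact: sqrtr_ge0. Qed.

Lemma normc_sqrE (x : R[i]) : normc x ^+ 2 = complex.Re x ^+ 2 + complex.Im x ^+ 2.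
Proof. by case: x => a b /=; rewrite sqr_sqrtr// addr_ge0// sqr_ge0. Qed.

Lemma normcX (x : R[i]) m : normc (x ^+ m) = normc x ^+ m.
Proof.
elim: m => [|m IHm]; first by rewrite !expr0 ComplexField.Normc.normc1.
by rewrite !exprS ComplexField.Normc.normcM IHm.
Qed.

Lemma cmeasurable_normc_sqr (u : H -> R[i]) D : cmeasurable u ->
  measurable_fun D (fun p => (normc (u p) ^+ 2)%:E).
Proof.
move=> [ru iu]; apply: measurable_funTS; apply/measurable_EFinP.
under eq_fun do rewrite normc_sqrE.
by apply: measurable_funD; exact: measurable_funX.
Qed.

Lemma mass_ge0 D u : (0 <= mass D u)%E.
Proof. by apply: integral_ge0 => p _; rewrite lee_fin sqr_ge0. Qed.

Lemma le_mass_setT D u : measurable D -> cmeasurable u -> (mass D u <= mass setT u)%E.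
Proof.
move=> mD mu_; apply: ge0_subset_integral => //.
- exact: cmeasurable_normc_sqr.
- by move=> p _; rewrite lee_fin sqr_ge0.
Qed.

Lemma le_mass D u w : measurable D -> cmeasurable u -> cmeasurable w ->
  (forall p, D p -> normc (u p) <= normc (w p)) -> (mass D u <= mass D w)%E.
Proof.
move=> mD cu cw uw; apply: ge0_le_integral => //.
- by move=> p _; rewrite lee_fin sqr_ge0.
- exact: cmeasurable_normc_sqr.
- exact: cmeasurable_normc_sqr.
- move=> p Dp; rewrite lee_fin lerXn2r ?nnegrE ?normc_ge0//; exact: uw.
Qed.

Lemma massZ D (c : R[i]) u : measurable D -> cmeasurable u ->
  mass D (fun p => c * u p) = ((normc c ^+ 2)%:E * mass D u)%E.
Proof.
move=> mD cu; rewrite /mass -ge0_integralZl_EFin ?sqr_ge0//.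
- by apply: eq_integral => p _; rewrite ComplexField.Normc.normcM exprMn EFinM.
- by move=> p _; rewrite lee_fin sqr_ge0.
- exact: cmeasurable_normc_sqr.
Qed.

(** Weighted Young inequality: the pointwise defect is the square [(e * a - b) ^+ 2 / e]. Optimising
    over [e] yields the triangle inequality without Cauchy-Schwarz; elsewhere [e = 1] is enough. *)
Lemma massD D (e : R) u w : measurable D -> 0 < e -> cmeasurable u -> cmeasurable w ->
  (mass D (fun p => (u p + w p)%R) <=
   (1 + e)%:E * mass D u + (1 + e^-1)%:E * mass D w)%E.
Proof.
move=> mD e0 cu cw.
have e1 : 0 <= 1 + e by rewrite addr_ge0// ltW.
have e2 : 0 <= 1 + e^-1 by rewrite addr_ge0// invr_ge0 ltW.
have mu2 := cmeasurable_normc_sqr (D := D) cu.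
have mw2 := cmeasurable_normc_sqr (D := D) cw.
rewrite /mass -!ge0_integralZl_EFin//; try by move=> p _; rewrite lee_fin sqr_ge0.
rewrite -ge0_integralD//; last 4 first.
- by move=> p _; rewrite -EFinM lee_fin mulr_ge0// sqr_ge0.
- exact: measurable_funeM.
- by move=> p _; rewrite -EFinM lee_fin mulr_ge0// sqr_ge0.
- exact: measurable_funeM.
apply: ge0_le_integral => //.
- by move=> p _; rewrite lee_fin sqr_ge0.
- exact: cmeasurable_normc_sqr (cmeasurableD cu cw).
- by apply: emeasurable_funD; exact: measurable_funeM.
move=> p _; rewrite -!EFinM -EFinD lee_fin.
have := le_normcD (u p) (w p).
set a := normc (u p); set b := normc (w p); set c := normc _ => cab.
have a0 : 0 <= a by exact: normc_ge0.
have b0 : 0 <= b by exact: normc_ge0.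
have c0 : 0 <= c by exact: normc_ge0.
apply: (@le_trans _ _ ((a + b) ^+ 2)).
  by rewrite lerXn2r// nnegrE// addr_ge0.
rewrite -subr_ge0.
have -> : (1 + e) * a ^+ 2 + (1 + e^-1) * b ^+ 2 - (a + b) ^+ 2 = (e * a - b) ^+ 2 / e.
  by field; rewrite gt_eqF.
by rewrite divr_ge0 ?sqr_ge0// ltW.
Qed.

Lemma L2D u w : L2 u -> L2 w -> L2 (fun p => u p + w p).
Proof.
move=> [ru iu lu] [rw iw lw].
have [rD iD] := cmeasurableD (conj ru iu) (conj rw iw); split => //.
apply: le_lt_trans (massD measurableT ltr01 (conj ru iu) (conj rw iw)) _.
by rewrite lte_add_pinfty// lte_mul_pinfty// lee_fin addr_ge0// invr_ge0.
Qed.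

Lemma L2Z (c : R[i]) u : L2 u -> L2 (fun p => c * u p).
Proof.
move=> [ru iu lu].
have [rD iD] := cmeasurableM (cmeasurable_cst c) (conj ru iu); split => //.
by rewrite massZ// lte_mul_pinfty// lee_fin sqr_ge0.
Qed.

Lemma L2B u w : L2 u -> L2 w -> L2 (fun p => u p - w p).
Proof.
move=> Lu Lw; under eq_fun do rewrite -[- w _]mulN1r.
exact: L2D Lu (L2Z (-1) Lw).
Qed.

Lemma ae_mono (P Q : H -> Prop) : (forall p, P p -> Q p) ->
  {ae mu, forall p, P p} -> {ae mu, forall p, Q p}.
Proof. by move=> PQ; apply: negligibleS => p /= nQ /PQ. Qed.

Lemma ae_eq_mass u w : L2 u -> L2 w -> {ae mu, forall p, u p = w p} ->
  mass setT u = mass setT w.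
Proof.
move=> Lu Lw uw; apply: ge0_ae_eq_integral => //.
- exact: cmeasurable_normc_sqr (L2_cmeasurable Lu).
- exact: cmeasurable_normc_sqr (L2_cmeasurable Lw).
- by move=> p _; rewrite lee_fin sqr_ge0.
- by move=> p _; rewrite lee_fin sqr_ge0.
- by apply: ae_mono uw => p uw _; rewrite uw.
Qed.

(** [fine] sends an infinite mass to 0, so the value is meaningful only for [u] in [L2]; hence the
    [L2] hypotheses of the triangle inequality and of the scaling rule. *)
Definition l2norm u : R := Num.sqrt (fine (mass setT u)).

Lemma l2norm_ge0 u : 0 <= l2norm u.
Proof. exact: sqrtr_ge0. Qed.

Lemma l2normK u : L2 u -> mass setT u = ((l2norm u) ^+ 2)%:E.
Proof.
move=> [_ _ lu]; rewrite /l2norm sqr_sqrtr ?fine_ge0 ?mass_ge0// fineK//.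
by rewrite ge0_fin_numE// mass_ge0.
Qed.

Lemma ler_l2normD u w : L2 u -> L2 w ->
  l2norm (fun p => u p + w p) <= l2norm u + l2norm w.
Proof.
move=> Lu Lw; apply/ler_addgt0Pr => d d0.
have Luw := L2D Lu Lw.
set a := l2norm u; set b := l2norm w; set c := l2norm _.
have a0 : 0 <= a by exact: l2norm_ge0.
have b0 : 0 <= b by exact: l2norm_ge0.
have c0 : 0 <= c by exact: l2norm_ge0.
(* The optimal parameter in [massD] is the ratio of the norms; adding [d / 2] makes both terms
   positive even if a norm vanishes. *)
pose a' := a + d / 2; pose b' := b + d / 2.
have a'0 : 0 < a' by rewrite ltr_wpDl// divr_gt0.
have b'0 : 0 < b' by rewrite ltr_wpDl// divr_gt0.
have e0 : 0 < b' / a' by rewrite divr_gt0.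
have := massD measurableT e0 (L2_cmeasurable Lu) (L2_cmeasurable Lw).
rewrite (l2normK Lu) (l2normK Lw) (l2normK Luw) -!EFinM -EFinD lee_fin.
rewrite -/a -/b -/c => h.
have -> : a + b + d = a' + b' by rewrite /a' /b'; field.
have ab0 : 0 <= a' + b' by rewrite addr_ge0// ltW.
rewrite -(@ler_pXn2r _ 2)//.
apply: (le_trans h).
have -> : (a' + b') ^+ 2 = (1 + b' / a') * a' ^+ 2 + (1 + (b' / a')^-1) * b' ^+ 2.
  by field; rewrite !gt_eqF.
apply: lerD; apply: ler_wpM2l.
- by rewrite addr_ge0// ltW.
- by rewrite lerXn2r ?nnegrE ?(ltW a'0)// lerDl divr_ge0// ltW.
- by rewrite addr_ge0// invr_ge0 ltW.
- by rewrite lerXn2r ?nnegrE ?(ltW b'0)// lerDl divr_ge0// ltW.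
Qed.

Lemma l2normZ (c : R[i]) u : L2 u -> l2norm (fun p => c * u p) = normc c * l2norm u.
Proof.
move=> Lu; rewrite /l2norm massZ//; last exact: L2_cmeasurable.
have [_ _ lu] := Lu.
rewrite fineM//; last by rewrite ge0_fin_numE// mass_ge0.
by rewrite sqrtrM ?sqr_ge0// sqrtr_sqr ger0_norm// normc_ge0.
Qed.

Lemma ae_eq_l2norm u w : L2 u -> L2 w -> {ae mu, forall p, u p = w p} ->
  l2norm u = l2norm w.
Proof. by move=> Lu Lw uw; rewrite /l2norm (ae_eq_mass Lu Lw uw). Qed.

Lemma L2_le_weight u C : cmeasurable u ->
  (forall p, normc (u p) ^+ 2 <= C * weight p) -> L2 u.
Proof.
move=> cu uC; split; [exact: cu.1|exact: cu.2|].
have C0 : 0 <= C.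
  by have := le_trans (sqr_ge0 _) (uC 0); rewrite pmulr_lge0// weight_gt0.
apply: (@le_lt_trans _ _ (C%:E * \int[mu]_p (weight p)%:E)%E); last first.
  by rewrite lte_mul_pinfty// integral_weight_lty.
have mw : measurable_fun setT (EFin \o @weight R n).
  by apply/measurable_EFinP; exact: measurable_weight.
rewrite -ge0_integralZl_EFin//; last by move=> p _; rewrite lee_fin ltW// weight_gt0.
apply: ge0_le_integral => //.
- by move=> p _; rewrite lee_fin sqr_ge0.
- exact: cmeasurable_normc_sqr.
- exact: measurable_funeM.
- by move=> p _; rewrite -EFinM lee_fin.
Qed.

End L2_norm.

(** * Square integrability of the kernels and their expansion in the translation parameter *)

Section kernel_L2.
Context {R : realType} (n : nat).
Local Notation H := (heis R n).
Local Notation mu := (heis_measure R n).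
Local Notation normc := ComplexField.Normc.normc.
Implicit Types (p : H) (tau : R).

Lemma normc_cayley_sqr tau p : normc (cayley tau p) ^+ 2 =
  complex.Re (cayley tau p) ^+ 2 + (tau - p.2) ^+ 2.
Proof. by rewrite normc_sqrE. Qed.

Lemma Re_le_normc (x : R[i]) : complex.Re x <= normc x.
Proof.
case: x => a b /=; apply: (le_trans (ler_norm a)).
by rewrite -sqrtr_sqr ler_wsqrtr// lerDl sqr_ge0.
Qed.

Lemma normc_real (a : R) : normc a%:C%C = `|a|.
Proof. by rewrite /= expr0n addr0 sqrtr_sqr. Qed.

Lemma normc_nat k : normc (k%:R : R[i]) = k%:R.
Proof.
by rewrite -[k%:R](rmorph_nat (real_complex R)) normc_real normr_nat.
Qed.

Lemma normcN1 : normc (-1 : R[i]) = 1.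
Proof. by rewrite -[-1](rmorphN1 (real_complex R)) normc_real normrN1. Qed.

Lemma normc_cayley_ge1 tau p : 1 <= normc (cayley tau p).
Proof. exact: le_trans (Re_cayley_ge1 tau p) (Re_le_normc _). Qed.

Lemma normc_cayley_gt0 tau p : 0 < normc (cayley tau p).
Proof. exact: lt_le_trans ltr01 (normc_cayley_ge1 tau p). Qed.

Lemma normc_kern tau m p : normc (kern tau m p) = (normc (cayley tau p))^-1 ^+ m.
Proof. by rewrite /kern normcX ComplexField.Normc.normcV. Qed.

Lemma Re_cayley_ge_x tau p i :
  1 + p.1.1 ord0 i ^+ 2 / 4 <= complex.Re (cayley tau p).
Proof.
rewrite /= lerD2l (bigD1 i)//= mulrDl -addrA lerDl addr_ge0//.
  by rewrite divr_ge0// sqr_ge0.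
by apply: sumr_ge0 => k _; rewrite divr_ge0// addr_ge0// sqr_ge0.
Qed.

Lemma Re_cayley_ge_y tau p i :
  1 + p.1.2 ord0 i ^+ 2 / 4 <= complex.Re (cayley tau p).
Proof.
rewrite /= lerD2l (bigD1 i)//= mulrDl [X in _ <= X + _]addrC -addrA lerDl addr_ge0//.
  by rewrite divr_ge0// sqr_ge0.
by apply: sumr_ge0 => k _; rewrite divr_ge0// addr_ge0// sqr_ge0.
Qed.

Let normc_sqr_lorentz tau p (x k : R) : 0 < k ->
  1 + x ^+ 2 <= k * normc (cayley tau p) ^+ 2 ->
  (normc (cayley tau p) ^+ 2)^-1 <= k * lorentz x.
Proof.
move=> k0 h; rewrite /lorentz.
have N0 : 0 < normc (cayley tau p) ^+ 2 by rewrite exprn_gt0// normc_cayley_gt0.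
have x0 : 0 < 1 + x ^+ 2 by rewrite ltr_pwDl// sqr_ge0.
by rewrite ler_pdivlMr// mulrC ler_pdivrMr.
Qed.

Let Re_le_sqr tau p : complex.Re (cayley tau p) <= normc (cayley tau p) ^+ 2.
Proof.
apply: (le_trans (Re_le_normc _)); rewrite expr2 ler_peMr ?normc_cayley_ge1//.
exact/ltW/normc_cayley_gt0.
Qed.

(** The squared modulus is [q ^+ m] with [q] the inverse square modulus of [cayley], and [q] alone
    is bounded by a multiple of [lorentz] of any single coordinate. Spending one factor [q <= 1] on
    each of the 2n + 1 coordinates gives the threshold on [m]; the constant [2 * (1 + tau ^+ 2)]
    pays for the translation in [t]. *)
Lemma kern_le_weight tau m p : (n + n + 1 <= m)%N ->
  normc (kern tau m p) ^+ 2 <=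
  4 ^+ n * 4 ^+ n * (2 * (1 + tau ^+ 2)) * weight p.
Proof.
move=> nm; set q := (normc (cayley tau p) ^+ 2)^-1.
have t0 : 0 < 2 * (1 + tau ^+ 2) :> R by rewrite mulr_gt0// ltr_pwDl// sqr_ge0.
have q0 : 0 < q by rewrite invr_gt0 exprn_gt0// normc_cayley_gt0.
have q1 : q <= 1.
  by rewrite invf_le1 ?exprn_gt0 ?normc_cayley_gt0// exprn_ege1// normc_cayley_ge1.
have -> : normc (kern tau m p) ^+ 2 = q ^+ m.
  by rewrite normc_kern /q -exprVn -!exprM mulnC.
have qx i : q <= 4 * lorentz (p.1.1 ord0 i).
  apply: normc_sqr_lorentz => //.
  by have := Re_cayley_ge_x tau p i; have := Re_le_sqr tau p; lra.
have qy i : q <= 4 * lorentz (p.1.2 ord0 i).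
  apply: normc_sqr_lorentz => //.
  by have := Re_cayley_ge_y tau p i; have := Re_le_sqr tau p; lra.
have qt : q <= (2 * (1 + tau ^+ 2)) * lorentz p.2.
  apply: normc_sqr_lorentz => //; rewrite normc_cayley_sqr.
  apply: (@le_trans _ _ (2 * (1 + tau ^+ 2) * (1 + (tau - p.2) ^+ 2))).
    rewrite -subr_ge0.
    have -> : 2 * (1 + tau ^+ 2) * (1 + (tau - p.2) ^+ 2) - (1 + p.2 ^+ 2) =
      1 + (2 * tau - p.2) ^+ 2 + 2 * (tau * (tau - p.2)) ^+ 2 by ring.
    by rewrite !addr_ge0// ?sqr_ge0// mulr_ge0// sqr_ge0.
  rewrite ler_wpM2l ?(ltW t0)// lerD2r exprn_ege1//; exact: Re_cayley_ge1.
have qn (f : 'I_n -> R) : (forall i, q <= 4 * lorentz (f i)) ->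
    q ^+ n <= 4 ^+ n * \prod_(i < n) lorentz (f i).
  move=> qf.
  have <- : \prod_(i < n) q = q ^+ n by rewrite prodr_const card_ord.
  have <- : \prod_(i < n) (4 : R) = 4 ^+ n by rewrite prodr_const card_ord.
  by rewrite -big_split /=; apply: ler_prod => i _; rewrite (ltW q0) qf.
apply: (@le_trans _ _ (q ^+ (n + n + 1))).
  by rewrite ler_wiXn2l// ltW.
rewrite !exprD expr1 /weight.
have -> (a b c : R) : 4 ^+ n * 4 ^+ n * c * (a * b * lorentz p.2) =
  (4 ^+ n * a) * (4 ^+ n * b) * (c * lorentz p.2) by ring.
by rewrite !ler_pM ?mulr_ge0 ?exprn_ge0 ?(ltW q0)//; exact: qn.
Qed.

Lemma L2_kern tau m : (n + n + 1 <= m)%N -> L2 (kern tau m : H -> R[i]).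
Proof.
move=> nm; apply: L2_le_weight; first exact/ccont_cmeasurable/ccont_kern.
by move=> p; exact: kern_le_weight.
Qed.

Lemma L2_sublaplacian_kern tau m : (n + n + 1 <= m)%N ->
  L2_sublaplacian (kern tau m : H -> R[i])
    (fun p => - (n%:R * m%:R * kern tau m.+1 p)).
Proof.
move=> nm; split; first exact: L2_kern.
  under eq_fun do rewrite -mulNr.
  by apply/L2Z/L2_kern; rewrite (leq_trans nm).
move=> phi tphi.
have Mr (x : R[i]) (a : R) : x * a%:C%C = Complex (complex.Re x * a) (complex.Im x * a).
  by case: x => b c; apply/eqP; rewrite eq_complex /=; apply/andP; split; apply/eqP; ring.
rewrite /cintegral; congr Complex.
- transitivity (\int[mu]_p (complex.Re (kern tau m p) * sublaplacian phi p)).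
    by apply: eq_Rintegral => p _; rewrite Mr.
  rewrite (@weak_kern R n (@complex.Re R)) //.
  + by apply: eq_Rintegral => p _; rewrite Mr.
  + exact: ReD.
  + by move=> a [b c] /=; ring.
  + by move=> u [].
  + by move=> v u u' [].
- transitivity (\int[mu]_p (complex.Im (kern tau m p) * sublaplacian phi p)).
    by apply: eq_Rintegral => p _; rewrite Mr.
  rewrite (@weak_kern R n (@complex.Im R)) //.
  + by apply: eq_Rintegral => p _; rewrite Mr.
  + exact: ImD.
  + by move=> a [b c] /=; ring.
  + by move=> u [].
  + by move=> v u u' [].
Qed.

(* Second-order Taylor bound for the translate of the kernel, by induction on
   [m]: the remainders satisfy
   [d (m + 1) = d m / b - delta^2 (m + 1) / (a^(m + 2) b)]. *)
Lemma kern_taylor m : exists2 C : R, 0 <= C & forall tau delta p, `|delta| <= 1 ->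
  normc (kern (tau + delta) m p - kern tau m p
    + Complex 0 delta * (m%:R * kern tau m.+1 p)) <=
  C * delta ^+ 2 * normc (kern tau m p).
Proof.
elim: m => [|m [C C0 IH]].
  exists 0 => // tau delta p _.
  by rewrite /kern !expr0 subrr mul0r mulr0 addr0 ComplexField.Normc.normc0 !mul0r.
(* The 2 comes from [|b|^-1 <= 2 * |a|^-1], which multiplies the previous remainder; [m.+1%:R] comes
   from the new term in [delta ^+ 2]. *)
exists (2 * C + m.+1%:R); first by rewrite addr_ge0// mulr_ge0.
move=> tau delta p d1; have := IH tau delta p d1.
set d := (X in normc X <= _) => IHd.
set a := cayley tau p; set b := cayley (tau + delta) p.
have abE : b = a + Complex 0 delta.
  by apply/eqP; rewrite eq_complex /=; apply/andP; split; apply/eqP; ring.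
have a0 : a != 0 by exact: cayley_neq0.
have b0 : b != 0 by exact: cayley_neq0.
have dE : kern (tau + delta) m.+1 p - kern tau m.+1 p
    + Complex 0 delta * (m.+1%:R * kern tau m.+2 p) =
    b^-1 * d + (Complex 0 delta * Complex 0 delta) *
      (m.+1%:R * a^-1 * b^-1 * kern tau m.+1 p).
  rewrite /d /kern -/a -/b !exprS -natr1.
  have -> : Complex 0 delta = b - a by rewrite abE addrC addKr.
  move: (a^-1 ^+ m) (b^-1 ^+ m) => x y.
  by field; rewrite a0 b0.
have na : 1 <= normc a by exact: normc_cayley_ge1.
have nb : 1 <= normc b by exact: normc_cayley_ge1.
have nd : normc (Complex 0 delta) = `|delta| by rewrite /= expr0n add0r sqrtr_sqr.
(* [|a| <= |b| + |delta|], and [|delta| <= 1 <= |b|]. *)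
have nab : normc a <= 2 * normc b.
  have -> : a = b + (- Complex 0 delta) by rewrite abE addrK.
  apply: (le_trans (le_normcD _ _)); rewrite normcN nd.
  by rewrite mulr_natl mulr2n lerD2l (le_trans d1).
rewrite dE (le_trans (le_normcD _ _))// !ComplexField.Normc.normcM.
rewrite !ComplexField.Normc.normcV nd.
rewrite (normc_nat m.+1).
set K := normc (kern tau m p).
have KE : normc (kern tau m.+1 p) = (normc a)^-1 * K by rewrite /K !normc_kern exprS.
rewrite KE.
have K0 : 0 <= K by exact: normc_ge0.
set x := (normc a)^-1; set y := (normc b)^-1.
have x0 : 0 <= x by rewrite invr_ge0 (le_trans _ na).
have y0 : 0 <= y by rewrite invr_ge0 (le_trans _ nb).
have x1 : x <= 1 by rewrite invf_le1// (lt_le_trans _ na).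
have y1 : y <= 1 by rewrite invf_le1// (lt_le_trans _ nb).
have yx : y <= 2 * x.
  rewrite /x /y ler_pdivlMr ?(lt_le_trans _ na)// mulrC ler_pdivrMr//.
  by rewrite (lt_le_trans _ nb).
have dd : `|delta| * `|delta| = delta ^+ 2 by rewrite -expr2 real_normK// num_real.
rewrite dd [leRHS](_ : _ =
  2 * x * (C * delta ^+ 2 * K) + m.+1%:R * delta ^+ 2 * (x * K)); last ring.
apply: lerD.
  by apply: ler_pM => //; exact: normc_ge0.
rewrite [leLHS](_ : _ = (m.+1%:R * delta ^+ 2 * (x * K)) * (x * y)); last ring.
apply: ler_piMr; last exact: mulr_ile1.
by apply: mulr_ge0; apply: mulr_ge0; rewrite ?sqr_ge0.
Qed.

End kernel_L2.

(** * Evolution of the explicit solutions *)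

Section propagation.
Context {R : realType} (n : nat).
Local Notation H := (heis R n).
Local Notation mu := (heis_measure R n).
Local Notation normc := ComplexField.Normc.normc.
Implicit Types (p : H) (u : H -> R[i]).

Let generated (tau : R) m p : R[i] := - (n%:R * m%:R * kern tau m.+1 p).

Lemma l2norm_near0 (F : R -> H -> R[i]) (l : set_system R) {FF : Filter l} :
  mass setT (F h) @[h --> l] --> 0%E ->
  l2norm (F h) @[h --> l] --> 0.
Proof.
move=> /fine_cvgP[_ F0]; rewrite /l2norm -[X in _ --> X]sqrtr0.
exact: (cvg_comp _ _ F0 (@sqrt_continuous R 0)).
Qed.

(** The Taylor remainder for [delta = n%:R * h], divided by [h], is pointwise at most
    [C * n%:R ^+ 2 * |h|] times the kernel itself, so the L^2 norm is of order [h] and no further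
    integral has to be estimated. *)
Lemma kern_quotient (m : nat) (tau : R) : (n + n + 1 <= m)%N ->
  l2norm (fun p => (h^-1)%:C%C * (kern (tau + n%:R * h) m p - kern tau m p)
     - 'i%C * generated tau m p) @[h --> (0 : R)^'] --> 0.
Proof.
move=> nm; have [C C0 HC] := @kern_taylor R n m.
have Lk : L2 (kern tau m : H -> R[i]) by exact: L2_kern.
pose K := C * n%:R ^+ 2 * l2norm (kern tau m : H -> R[i]).
have K0 : 0 <= K by rewrite !mulr_ge0 ?exprn_ge0// l2norm_ge0.
apply/cvgr0Pnorm_lt => e e0; near=> h.
have h0 : h != 0 by near: h; exact: nbhs_dnbhs_neq.
have hn : `|n%:R * h| <= 1.
  rewrite normrM normr_nat.
  have : `|h| <= (n%:R + 1)^-1.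
    near: h; apply: dnbhs0_le; rewrite invr_gt0; exact: ltr_wpDl.
  rewrite -[_^-1]mul1r ler_pdivlMr ?ltr_wpDl// mulrDr mulr1 mulrC.
  by have := normr_ge0 h; lra.
have hK : `|h| < e / (K + 1).
  by near: h; apply: dnbhs0_lt; rewrite divr_gt0// ltr_wpDl.
rewrite ger0_norm ?l2norm_ge0//.
pose c : R[i] := (C * n%:R ^+ 2 * `|h|)%:C%C.
have Lc : L2 (fun p : H => c * kern tau m p) by exact: L2Z _ Lk.
apply: (@le_lt_trans _ _ (l2norm (fun p : H => c * kern tau m p))); last first.
  rewrite (l2normZ _ Lk) normc_real ger0_norm ?mulr_ge0 ?exprn_ge0//.
  rewrite mulrAC -/K (@le_lt_trans _ _ ((K + 1) * `|h|))//.
    by rewrite ler_wpM2r// lerDl.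
  by rewrite mulrC -ltr_pdivlMr// ltr_wpDl.
have Lq : L2 (fun p : H => (h^-1)%:C%C * (kern (tau + n%:R * h) m p - kern tau m p)
     - 'i%C * generated tau m p).
  have [_ Lv _] := L2_sublaplacian_kern tau nm.
  exact: L2B (L2Z _ (L2B (L2_kern _ nm) Lk)) (L2Z _ Lv).
apply: ler_wsqrtr; apply: fine_le.
- by rewrite ge0_fin_numE ?mass_ge0//; case: Lq.
- by rewrite ge0_fin_numE ?mass_ge0//; case: Lc.
apply: (le_mass measurableT (L2_cmeasurable Lq) (L2_cmeasurable Lc)) => p _.
rewrite [leRHS]ComplexField.Normc.normcM normc_real ger0_norm; last first.
  by rewrite !mulr_ge0 ?exprn_ge0.
(* Here the generator is matched with the translation: i times [generated] is the first-order Taylor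
   term for a translation of speed [n] along the center. *)
have -> : (h^-1)%:C%C * (kern (tau + n%:R * h) m p - kern tau m p)
     - 'i%C * generated tau m p = (h^-1)%:C%C * (kern (tau + n%:R * h) m p -
   kern tau m p + Complex 0 (n%:R * h) * (m%:R * kern tau m.+1 p)).
  rewrite [RHS]mulrDr; congr (_ + _); rewrite /generated.
  have -> : Complex 0 (n%:R * h) = h%:C%C * n%:R * 'i%C.
    rewrite -[n%:R in RHS](rmorph_nat (real_complex R)).
    by apply/eqP; rewrite eq_complex /=; apply/andP; split; apply/eqP; ring.
  rewrite fmorphV; field.
  by rewrite eq_complex /= negb_and h0.
rewrite ComplexField.Normc.normcM normc_real normfV.
rewrite ler_pdivrMl ?normr_gt0//; apply: (le_trans (HC _ _ _ hn)).
have -> : C * (n%:R * h) ^+ 2 = `|h| * (C * n%:R ^+ 2 * `|h|).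
  have -> : (n%:R * h) ^+ 2 = n%:R ^+ 2 * (`|h| * `|h|).
    by rewrite exprMn -[h ^+ 2]real_normK ?num_real.
  by ring.
by rewrite -[leLHS]mulrA.
Unshelve. all: by end_near. Qed.

Variable U : R -> (H -> R[i]) -> H -> R[i].
Hypothesis UP : is_schrodinger_group U.

Lemma group_quotient (u v : H -> R[i]) : L2_sublaplacian u v ->
  l2norm (fun p => (h^-1)%:C%C * (U h u p - u p) - 'i%C * v p) @[h --> (0 : R)^'] --> 0.
Proof.
move=> uv; have [Lu Lv _] := uv.
by apply: l2norm_near0; apply/(group_generator UP).
Qed.

Lemma group_sub h u w : L2 u -> L2 w ->
  {ae mu, forall p, U h (fun q => u q - w q) p = U h u p - U h w p}.
Proof.
move=> Lu Lw; have := group_linear UP h (-1) Lw Lu.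
have -> : (fun q => -1 * w q + u q) = (fun q => u q - w q).
  by apply/funext => q; rewrite mulN1r addrC.
by apply: ae_mono => p ->; rewrite mulN1r addrC.
Qed.

(* For every [w] on the explicit curve, [U h w] and the translate of [w] have the
   same derivative at [h = 0]; as [U h] is an isometry, the norm of the difference
   of the two curves has derivative zero everywhere. *)
Lemma group_kern m s : (n + n + 1 <= m)%N ->
  l2norm (fun p => U s (kern 0 m) p - kern (n%:R * s) m p) = 0.
Proof.
move=> nm; set f := kern 0 m : H -> R[i].
have Lf : L2 f by exact: L2_kern.
pose phi s := l2norm (fun p => U s f p - kern (n%:R * s) m p).
have Lk t : L2 (kern t m : H -> R[i]) by exact: L2_kern.
have LU t u : L2 u -> L2 (U t u) by exact: group_L2.
have phi0 : phi 0 = 0.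
  rewrite /phi (@ae_eq_l2norm _ _ _ (fun p => f p - f p)).
  - rewrite (_ : (fun p => f p - f p) = fun p => 0 * f p); last first.
      by apply/funext => p; rewrite subrr mul0r.
    by rewrite (l2normZ _ Lf) ComplexField.Normc.normc0 mul0r.
  - exact: L2B (LU _ _ Lf) (Lk _).
  - exact: (L2B Lf Lf).
  - by apply: (ae_mono _ (group_0 UP Lf)) => p ->; rewrite mulr0.
suff dphi (t : R) : is_derive t 1 phi 0.
  by rewrite -/(phi s) (is_derive_0_is_cst (f := phi) s 0 dphi).
pose w := kern (n%:R * t) m : H -> R[i].
have Lw : L2 w by exact: Lk.
pose EU h := l2norm (fun p =>
  (h^-1)%:C%C * (U h w p - w p) - 'i%C * generated (n%:R * t) m p).
pose ET h := l2norm (fun p => (h^-1)%:C%C * (kern (n%:R * t + n%:R * h) m p - w p)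
     - 'i%C * generated (n%:R * t) m p).
have EU0 : EU h @[h --> (0 : R)^'] --> 0.
  exact/group_quotient/L2_sublaplacian_kern.
have ET0 : ET h @[h --> (0 : R)^'] --> 0 by exact: kern_quotient.
have E0 : EU h + ET h @[h --> (0 : R)^'] --> 0.
  by rewrite -[X in _ --> X](addr0 0); exact: cvgD.
have Lv : L2 (generated (n%:R * t) m) by have [] := L2_sublaplacian_kern (n%:R * t) nm.
(* By the group law [phi (t + h)] is the norm of [U h g - w_h], and by isometry [phi t] is that of
   [U h g - U h w]; their difference is at most the norm of [U h w - w_h]. The generator is thus
   only applied to the explicit function [w], never to [g]. *)
have step h : h != 0 -> `|phi (t + h) - phi t| <= `|h| * (EU h + ET h).
  move=> h0.
  pose g := U t f.
  pose w_h := kern (n%:R * (t + h)) m : H -> R[i].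
  have Lg : L2 g by exact: LU.
  have Lwh : L2 w_h by exact: Lk.
  have LUw : L2 (U h w) by exact: LU.
  have LUg : L2 (U h g) by exact: LU.
  pose r := l2norm (fun p => U h w p - w_h p).
  have Lr : L2 (fun p => U h w p - w_h p) by exact: L2B LUw Lwh.
  have rE : r <= `|h| * (EU h + ET h).
    pose eu p := (h^-1)%:C%C * (U h w p - w p) - 'i%C * generated (n%:R * t) m p.
    pose et p := (h^-1)%:C%C * (kern (n%:R * t + n%:R * h) m p - w p)
      - 'i%C * generated (n%:R * t) m p.
    have Leu : L2 eu by exact: L2B (L2Z _ (L2B LUw Lw)) (L2Z _ Lv).
    have Let_ : L2 et.
      by exact: L2B (L2Z _ (L2B (Lk _) Lw)) (L2Z _ Lv).
    (* In [eu - et] the base point [w] and the common derivative cancel. *)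
    rewrite /r (_ : (fun p => _) = fun p => h%:C%C * (eu p + -1 * et p)); last first.
      apply/funext => p; rewrite /eu /et /w_h mulrDr fmorphV; field.
      by rewrite eq_complex /= negb_and h0.
    rewrite (l2normZ _ (L2D Leu (L2Z _ Let_))) normc_real.
    rewrite ler_wpM2l// (le_trans (ler_l2normD Leu (L2Z _ Let_)))//.
    by rewrite (l2normZ _ Let_) normcN1 mul1r.
  apply: le_trans rE; rewrite -/r.
  have iso : l2norm (fun p => U h g p - U h w p) = phi t.
    rewrite /phi -/g -/w -(ae_eq_l2norm _ _ (group_sub h Lg Lw)).
    - by rewrite /l2norm (group_isometry UP h (L2B Lg Lw)).
    - exact: LU (L2B Lg Lw).
    - exact: L2B LUg LUw.
  have phih : phi (t + h) = l2norm (fun p => U h g p - w_h p).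
    rewrite /phi; apply: ae_eq_l2norm.
    - exact: L2B (LU _ _ Lf) Lwh.
    - exact: L2B LUg Lwh.
    - rewrite [t + h]addrC; apply: (ae_mono _ (group_D UP h t Lf)) => p ->.
      by rewrite /w_h [h + t]addrC.
  rewrite ler_distl; apply/andP; split.
    rewrite lerBlDr -iso phih.
    rewrite (_ : (fun p => U h g p - U h w p) =
      fun p => (U h g p - w_h p) + -1 * (U h w p - w_h p)); last first.
      by apply/funext => p; ring.
    have LZ : L2 (fun p => -1 * (U h w p - w_h p)) by exact: L2Z _ Lr.
    rewrite (le_trans (ler_l2normD (L2B LUg Lwh) LZ))// (l2normZ _ Lr).
    by rewrite normcN1 mul1r.
  rewrite phih -iso.
  rewrite (_ : (fun p => U h g p - w_h p) =
      fun p => (U h g p - U h w p) + (U h w p - w_h p)); last first.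
    by apply/funext => p; ring.
  exact: ler_l2normD (L2B LUg LUw) Lr.
have cv : (fun h : R => h^-1 *: ((phi \o shift t) (h *: 1) - phi t)) @ 0^' --> 0.
  apply/cvgr0Pnorm_lt => e e0.
  have E0e : \forall h \near (0 : R)^', `|EU h + ET h| < e.
    by move/cvgr0Pnorm_lt : (E0); apply.
  near=> h.
  have h0 : h != 0 by near: h; exact: nbhs_dnbhs_neq.
  have he : EU h + ET h < e.
    apply: (le_lt_trans (ler_norm _)); near: h; exact: E0e.
  rewrite /= [h *: 1]mulr1 [h + t]addrC normrM normfV.
  rewrite ltr_pdivrMl ?normr_gt0// (le_lt_trans (step h h0))//.
  by rewrite ltr_pM2l ?normr_gt0.
by split; [apply/cvg_ex; exists 0|exact/cvg_lim].
Unshelve. all: by end_near. Qed.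

End propagation.

(** * Concentration *)

Section concentration.
Context {R : realType} (n : nat).
Local Notation H := (heis R n).
Local Notation mu := (heis_measure R n).
Local Notation normc := ComplexField.Normc.normc.
Implicit Types (p : H) (tau : R).

Lemma measurable_cube r : measurable (@cube R n r).
Proof.
rewrite (_ : cube n r = \bigcap_(i in [set: 'I_n])
  (((fun z : 'rV[R]_n * 'rV[R]_n => z.1 ord0 i) @^-1` `[- r, r]) `&`
   ((fun z : 'rV[R]_n * 'rV[R]_n => z.2 ord0 i) @^-1` `[- r, r]))); last first.
  apply/seteqP; split => z /= zr i;
    first by move=> _; have [] := zr i; rewrite /= !in_itv/= -!ler_norml.
  by have [] := zr i I; rewrite /= !in_itv/= -!ler_norml.
apply: fin_bigcap_measurable; first exact: finite_finset.
move=> i _; apply: measurableI; rewrite -[X in measurable X]setTI.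
  have mx : measurable_fun setT (fun z : 'rV[R]_n * 'rV[R]_n => z.1 ord0 i).
    exact: measurableT_comp (@measurable_rV_coord _ _ _ i) measurable_fst.
  exact: (mx measurableT _ (measurable_itv _)).
have my : measurable_fun setT (fun z : 'rV[R]_n * 'rV[R]_n => z.2 ord0 i).
  exact: measurableT_comp (@measurable_rV_coord _ _ _ i) measurable_snd.
exact: (my measurableT _ (measurable_itv _)).
Qed.

(** Bounded in [t] as well, because [cayley 0] is close to 1 only near the origin. *)
Definition box (e : R) : set H := cube n e `*` `[- e, e]%classic.

Lemma measurable_box e : measurable (box e).
Proof. by apply: measurableX; [exact: measurable_cube|exact: measurable_itv]. Qed.

Definition rV_cube (e : R) : set 'rV[R]_n :=
  [set v | forall i, `[- e, e]%classic (v ord0 i)].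

Lemma lebesgue_rV_cube_gt0 (e : R) : 0 < e ->
  (0 < lebesgue_rV R n (rV_cube e))%E.
Proof.
move=> e0; rewrite /rV_cube (@lebesgue_rV_box R n (fun=> `[- e, e]%classic)); last first.
  by move=> i; exact: measurable_itv.
rewrite (eq_bigr (fun=> (2 * e)%:E)); last first.
  move=> i _; rewrite lebesgue_measure_itv/= lte_fin gtrN// -EFinD.
  by congr EFin; ring.
rewrite prodEFin prodr_const lte_fin exprn_gt0// mulr_gt0//.
Qed.

Lemma box_gt0 e : 0 < e -> (0 < mu (box e))%E.
Proof.
move=> e0; rewrite /box.
have VE : cube n e = rV_cube e `*` rV_cube e.
  apply/seteqP; split => z /=.
    by move=> ze; split => i; have [] := ze i; rewrite /= !in_itv/= -!ler_norml.
  by move=> [z1 z2] i; have := z1 i; have := z2 i; rewrite /= !in_itv/= -!ler_norml.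
have mV : measurable (rV_cube e).
  rewrite (_ : rV_cube e = \bigcap_(i in [set: 'I_n])
      ((fun v : 'rV[R]_n => v ord0 i) @^-1` `[- e, e]%classic)); last first.
    by apply/seteqP; split => v h i; [move=> _; exact: h|exact: h].
  apply: fin_bigcap_measurable; first exact: finite_finset.
  move=> i _; rewrite -[X in measurable X]setTI.
  have mi : measurable_fun setT (fun v : 'rV[R]_n => v ord0 i) by exact: measurable_rV_coord.
  exact: (mi measurableT _ (measurable_itv _)).
have mI : measurable (`[- e, e]%classic : set (measurableTypeR R)).
  exact: measurable_itv.
rewrite VE /heis_measure /= /sf_product product_measure1E//; last exact: measurableX.
have V0 : (0 < sf_product (lebesgue_rV R n) (lebesgue_rV R n) (rV_cube e `*` rV_cube e))%E.
  by rewrite /sf_product product_measure1E// mule_gt0// lebesgue_rV_cube_gt0.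
have I0 : (0 < lebesgue_measure (`[(- e)%R, e]%classic : set (measurableTypeR R)))%E.
  by rewrite lebesgue_measure_itv/= lte_fin gtrN// -EFinD lte_fin opprK addr_gt0.
exact: mule_gt0 V0 I0.
Qed.

(** Only the real part is used, so the bound is uniform in [t] and [tau]; the same rate therefore
    serves at both times. *)
Lemma normc_cayley_outside r tau p : 0 < r -> ~ cube n r p.1 ->
  1 + r ^+ 2 / 4 <= normc (cayley tau p).
Proof.
move=> r0 /existsNP[i /not_andP h]; apply: (le_trans _ (Re_le_normc _)).
have sq (x : R) : ~ `|x| <= r -> 1 + r ^+ 2 / 4 <= 1 + x ^+ 2 / 4.
  move=> /negP; rewrite -ltNge => rx; rewrite lerD2l ler_wpM2r// ?invr_ge0//.
  by rewrite -[x ^+ 2]real_normK ?num_real// lerXn2r ?nnegrE ?ltW// (lt_trans r0).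
by case: h => /sq/le_trans; apply; [exact: Re_cayley_ge_x|exact: Re_cayley_ge_y].
Qed.

(** On the box each pair of coordinates adds at most [e ^+ 2 / 2] to the real part, so the square
    modulus is at most [(1 + n%:R * e ^+ 2 / 2) ^+ 2 + e ^+ 2]; as [e <= 1], all higher powers of
    [e] are replaced by [e]. *)
Lemma normc_cayley_box e p : 0 < e -> e <= 1 -> box e p ->
  normc (cayley 0 p) ^+ 2 <= 1 + e * (n%:R + n%:R ^+ 2 + 1).
Proof.
move=> e0 e1 [pe]; rewrite /= in_itv/= -ler_norml => te.
have sq (x : R) : `|x| <= e -> x ^+ 2 <= e ^+ 2.
  by move=> xe; rewrite -[x ^+ 2]real_normK ?num_real// lerXn2r ?nnegrE// ltW.
have ee : e ^+ 2 <= e by rewrite expr2 ler_piMr// ltW.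
have e20 : 0 <= e ^+ 2 by exact: sqr_ge0.
set N : R := n%:R.
have N0 : 0 <= N by exact: ler0n.
have re : complex.Re (cayley 0 p) <= 1 + N * (e ^+ 2 / 2).
  rewrite /= lerD2l -[N]mulr1 -mulrA mul1r /N mulr_natl -[in leRHS](card_ord n) -sumr_const.
  apply: ler_sum => i _; have [/sq hx /sq hy] := pe i; lra.
have re0 := Re_cayley_ge1 0 p.
rewrite normc_cayley_sqr sub0r sqrrN.
have := sq _ te.
have : complex.Re (cayley 0 p) ^+ 2 <= (1 + N * (e ^+ 2 / 2)) ^+ 2.
  have re1 : 0 <= N * (e ^+ 2 / 2) by rewrite mulr_ge0// divr_ge0.
  by rewrite lerXn2r// nnegrE; lra.
have : N ^+ 2 * (e ^+ 2 * e ^+ 2) <= N ^+ 2 * (e * 1).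
  have h : e ^+ 2 * e ^+ 2 <= e * 1.
    by rewrite ler_pM// (le_trans ee).
  by rewrite ler_wpM2l// sqr_ge0.
have : N * e ^+ 2 <= N * e by rewrite ler_wpM2l.
have : 0 <= N ^+ 2 * e by rewrite mulr_ge0 ?sqr_ge0// ltW.
have -> : (1 + N * (e ^+ 2 / 2)) ^+ 2 =
  1 + N * e ^+ 2 + N ^+ 2 * (e ^+ 2 * e ^+ 2) / 4 by field.
rewrite mulr1 !mulrDr mulr1 [e * N]mulrC [e * N ^+ 2]mulrC.
move: (complex.Re _ ^+ 2) (N ^+ 2 * (e ^+ 2 * e ^+ 2)) (N ^+ 2 * e)
  (N * e) (N * e ^+ 2) => *.
lra.
Qed.

End concentration.

(** * Mass outside the cube and mass near the origin *)

Section concentration_mass.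
Context {R : realType} (n : nat).
Local Notation H := (heis R n).
Local Notation mu := (heis_measure R n).
Local Notation normc := ComplexField.Normc.normc.
Implicit Types (p : H) (tau r e : R).

Let outside r : set H := (~` cube n r) `*` setT.

Lemma measurable_outside r : measurable (outside r).
Proof. by apply: measurableX => //; apply: measurableC; exact: measurable_cube. Qed.

(** The exponent is split: [kern tau m] is kept for integrability, and each of the [k] remaining
    factors is bounded pointwise outside the cube. *)
Lemma mass_kern_outside r tau m k : 0 < r ->
  (mass (outside r) (kern tau (m + k)) <=
   (((1 + r ^+ 2 / 4)^-1 ^+ k) ^+ 2)%:E * mass (outside r) (kern tau m))%E.
Proof.
move=> r0; set rho := 1 + r ^+ 2 / 4.
have rho0 : 0 < rho by rewrite ltr_pwDl// divr_ge0// sqr_ge0.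
have cm j : cmeasurable (kern tau j : H -> R[i]).
  exact: ccont_cmeasurable (@ccont_kern R n tau j).
have mD := measurable_outside r.
have rk0 : 0 <= rho^-1 ^+ k by rewrite exprn_ge0// invr_ge0 ltW.
have := massZ (rho^-1 ^+ k)%:C%C mD (cm m).
rewrite normc_real ger0_norm// => <-.
apply: (le_mass mD (cm _) (cmeasurableM (cmeasurable_cst n _) (cm m))) => p [pc _].
rewrite ComplexField.Normc.normcM normc_real ger0_norm// !normc_kern exprD mulrC.
rewrite ler_wpM2r ?exprn_ge0 ?invr_ge0 ?normc_ge0//.
rewrite lerXn2r ?nnegrE ?invr_ge0 ?normc_ge0 ?(ltW rho0)//.
by rewrite lef_pV2 ?posrE ?normc_cayley_gt0//; exact: normc_cayley_outside.
Qed.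

Lemma mass_kern_box e m : 0 < e -> e <= 1 ->
  (((1 + e * (n%:R + n%:R ^+ 2 + 1))^-1 ^+ m)%:E * mu (box e) <=
   mass setT (kern 0 m : H -> R[i]))%E.
Proof.
move=> e0 e1; set sigma := 1 + _.
have cm : cmeasurable (kern 0 m : H -> R[i]).
  exact: ccont_cmeasurable (@ccont_kern R n 0 m).
have mB := @measurable_box R n e.
apply: le_trans (le_mass_setT mB cm); rewrite /mass -integral_cst//.
have sigma0 : 0 < sigma.
  by rewrite ltr_pwDl// mulr_ge0 ?(ltW e0)// !addr_ge0// sqr_ge0.
apply: ge0_le_integral => //.
- by move=> p _; rewrite lee_fin exprn_ge0// invr_ge0 ltW.
- exact: cmeasurable_normc_sqr.
move=> p Bp; rewrite lee_fin normc_kern -exprM mulnC exprM [in leRHS]exprVn.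
rewrite lerXn2r ?nnegrE ?invr_ge0 ?exprn_ge0 ?normc_ge0 ?(ltW sigma0)//.
rewrite lef_pV2 ?posrE ?exprn_gt0 ?normc_cayley_gt0//.
exact: normc_cayley_box.
Qed.

(** [group_kern] identifies the evolved function through a vanishing norm; [massD] with [e = 1]
    converts this into a bound on the outer region, at the price of a factor 2 that disappears into
    the final constant. *)
Lemma mass_group_kern_outside (U : R -> (H -> R[i]) -> H -> R[i]) r s m :
  is_schrodinger_group U -> (n + n + 1 <= m)%N ->
  (mass (outside r) (U s (kern 0 m)) <=
   2%:E * mass (outside r) (kern (n%:R * s)%R m : H -> R[i]))%E.
Proof.
move=> UP nm; have mD := measurable_outside r.
have Lk t : L2 (kern t m : H -> R[i]) by exact: L2_kern.
have Lg : L2 (U s (kern 0 m)) by exact: (group_L2 UP).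
have Ld := L2B Lg (Lk (n%:R * s)).
have d0 : mass (outside r) (fun p => U s (kern 0 m) p - kern (n%:R * s) m p) = 0%E.
  apply/eqP; rewrite eq_le mass_ge0 andbT.
  apply: (le_trans (le_mass_setT mD (L2_cmeasurable Ld))).
  by rewrite (l2normK Ld) (group_kern UP s nm) expr0n.
have := massD mD ltr01 (L2_cmeasurable (Lk (n%:R * s))) (L2_cmeasurable Ld).
rewrite d0 mule0 adde0.
have -> : (fun p => kern (n%:R * s) m p + (U s (kern 0 m) p - kern (n%:R * s) m p)) =
    U s (kern 0 m) by apply/funext => p; rewrite addrC subrK.
by rewrite -[(1 + 1)%R]/(2%R).
Qed.

End concentration_mass.

(** * Comparison of the two geometric rates *)

Theorem mainTheorem5 (R : realType) (n : nat) (r s1 s2 : R)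
    (U : R -> (heis R n -> R[i]) -> heis R n -> R[i]) :
  (1 <= n)%N -> 0 < r -> s1 < s2 -> is_schrodinger_group U ->
  ~ exists C : R, 0 < C /\
      forall u0 : heis R n -> R[i], L2 u0 ->
        (mass setT u0 <=
           C%:E * (mass ((~` cube n r) `*` setT) (U s1 u0) +
                   mass ((~` cube n r) `*` setT) (U s2 u0)))%E.
Proof.
move=> _ r0 _ UP [C [C0 ineq]].
pose rho : R := 1 + r ^+ 2 / 4.
have rho1 : 1 < rho by rewrite ltrDl divr_gt0// exprn_gt0.
have rho0 : 0 < rho by exact: lt_trans rho1.
have rho2 : 1 < rho ^+ 2 by rewrite exprn_egt1.
pose S : R := n%:R + n%:R ^+ 2 + 1.
have S0 : 0 < S by rewrite ltr_wpDl// addr_ge0// sqr_ge0.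
(* The box is small enough that [e * S <= (rho ^+ 2 - 1) / 2], where [S] is the coefficient in
   [normc_cayley_box]; this puts [sigma] strictly below [rho ^+ 2]. *)
pose e : R := Num.min 1 ((rho ^+ 2 - 1) / (2 * S)).
have e0 : 0 < e by rewrite lt_min ltr01 divr_gt0 ?subr_gt0// mulr_gt0.
have e1 : e <= 1 by rewrite ge_min lexx.
pose sigma : R := 1 + e * S.
have sigma0 : 0 < sigma by rewrite ltr_pwDl// mulr_ge0// ltW.
have sigma_rho : sigma < rho ^+ 2.
  have : e * S <= (rho ^+ 2 - 1) / 2.
    have -> : (rho ^+ 2 - 1) / 2 = (rho ^+ 2 - 1) / (2 * S) * S by field; rewrite gt_eqF.
    by rewrite ler_wpM2r ?(ltW S0)// ge_min lexx orbT.
  by rewrite /sigma; lra.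
pose m0 := (n + n + 1)%N.
pose D : set (heis R n) := (~` cube n r) `*` setT.
(* [K] does not depend on [k]: it only involves the masses at the fixed exponent [m0], the least one
   covered by [L2_kern]. *)
have [K HK] : exists K : R, forall k,
    (mass D (U s1 (kern 0 (m0 + k))) + mass D (U s2 (kern 0 (m0 + k))) <=
     (((rho^-1 ^+ k) ^+ 2) * K)%:E)%E.
  have Lk t : L2 (kern t m0 : heis R n -> R[i]) by exact: L2_kern.
  have Dfin t : (mass D (kern t m0) = (fine (mass D (kern t m0)))%:E)%E.
    have le_D : (mass D (kern t m0) <= mass setT (kern t m0 : heis R n -> R[i]))%E.
      exact: le_mass_setT (@measurable_outside R n r) (L2_cmeasurable (Lk t)).
    rewrite fineK// ge0_fin_numE ?mass_ge0//.
    by apply: (le_lt_trans le_D); have [] := Lk t.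
  exists (2 * fine (mass D (kern (n%:R * s1) m0)) +
    2 * fine (mass D (kern (n%:R * s2) m0))) => k.
  have B s : (mass D (U s (kern 0 (m0 + k))) <=
      ((rho^-1 ^+ k) ^+ 2 * (2 * fine (mass D (kern (n%:R * s) m0))))%:E)%E.
    apply: (le_trans (mass_group_kern_outside r s UP (leq_addr k m0))).
    have := @mass_kern_outside R n r (n%:R * s) m0 k r0.
    rewrite -/rho -/D Dfin -EFinM => h.
    rewrite mulrCA EFinM lee_wpmul2l//.
  by rewrite mulrDr EFinD; exact: leeD (B s1) (B s2).
(* A positive real lower bound for the measure of the box; were that measure infinite, 1 would
   serve. *)
have [b b0 bB] : exists2 b : R, 0 < b & (b%:E <= heis_measure R n (@box R n e))%E.
  have := @box_gt0 R n e e0; case: (heis_measure R n (@box R n e)) => [b b0| |//].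
    by exists b.
  by exists 1 => //; rewrite leey.
have key k : sigma^-1 ^+ (m0 + k) * b <= C * ((rho^-1 ^+ k) ^+ 2 * K).
  have Lf : L2 (kern 0 (m0 + k) : heis R n -> R[i]) by exact: L2_kern (leq_addr k m0).
  rewrite -lee_fin EFinM.
  apply: le_trans (le_trans (@mass_kern_box R n e (m0 + k) e0 e1)
    (le_trans (ineq _ Lf) _)).
    by rewrite lee_wpmul2l// lee_fin exprn_ge0// invr_ge0 ltW.
  by rewrite EFinM lee_wpmul2l ?lee_fin ?(ltW C0)//; exact: HK.
pose q := sigma / rho ^+ 2.
have q1 : `|q| < 1.
  by rewrite ger0_norm ?divr_ge0 ?(ltW sigma0) ?sqr_ge0// ltr_pdivrMr ?mul1r// exprn_gt0.
(* Multiplying [key] by [sigma ^+ k] leaves a positive constant on the left and a geometric sequence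
   of ratio [q < 1] on the right. *)
have qk k : sigma^-1 ^+ m0 * b <= C * K * q ^+ k.
  have := key k; rewrite exprD -(ler_pM2r (exprn_gt0 k sigma0)) => h.
  rewrite [leLHS](_ : _ = sigma^-1 ^+ m0 * sigma^-1 ^+ k * b * sigma ^+ k); last first.
    have sk : sigma^-1 ^+ k * sigma ^+ k = 1.
      by rewrite -exprMn mulVf ?expr1n// gt_eqF.
    by rewrite -[LHS]mulr1 -sk; ring.
  rewrite [leRHS](_ : _ = C * ((rho^-1 ^+ k) ^+ 2 * K) * sigma ^+ k)//.
  by rewrite /q exprMn !exprVn -!exprM mulnC; ring.
have c0 : 0 < sigma^-1 ^+ m0 * b by rewrite mulr_gt0// exprn_gt0// invr_gt0.
have : sigma^-1 ^+ m0 * b <= 0.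
  have cv : (fun k => C * K * q ^+ k) @ \oo --> (0 : R).
    by rewrite -[X in _ --> X](mulr0 (C * K)); apply: cvgMr; exact: cvg_expr.
  have /cvg_lim <- := cv; last exact: Rhausdorff.
  by apply: limr_ge; [exact: cvgP cv|exact: nearW].
by rewrite leNgt c0.
Qed.
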